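(* Suppose $L_\delta:L^2([0,1],\mathbb C)\to L^2([0,1],\mathbb C)$, $\delta\in[0,\bar\delta)$, are integral-preserving integral operators $L_\delta f(x)=\int k_\delta(x,y)f(y)\,dy$ with kernels $k_\delta\in L^2([0,1]^2)$ satisfying $\delta\mapsto k_\delta\in C^1([0,\bar\delta),L^2([0,1]^2))$. Suppose $L_0$ satisfies (A1): $\lim_{n\to\infty}\|L_0^ng\|_2=0$ for every $g$ with $\int g\,dm=0$. Let $\lambda_0\in\mathbb C$ be an eigenvalue of $L_0$ with the largest magnitude strictly inside the unit circle and assume that $\lambda_0$ is geometrically simple. Then there exists $\dot\lambda\in\mathbb C$ such that $$\lim_{\delta\to0}\left|\frac{\lambda_\delta-\lambda_0}{\delta}-\dot\lambda\right|=0 .$$ Furthermore, $$\dot\lambda=\int_0^1\!\!\int_0^1\dot k(x,y)\big(\Re(\hat e)(x)\Re(e)(y)+\Im(\hat e)(x)\Im(e)(y)\big)dy\,dx+i\int_0^1\!\!\int_0^1\dot k(x,y)\big(\Im(\hat e)(x)\Re(e)(y)-\Re(\hat e)(x)\Im(e)(y)\big)dy\,dx,$$ where $e\in L^2([0,1],\mathbb C)$ is the eigenvector of $L_0$ associated to the eigenvalue $\lambda_0$, $\hat e\in L^2([0,1],\mathbb C)$ is the eigenvector of $L_0^*$ associated to the eigenvalue $\lambda_0$, and $\dot k$ is the kernel of the derivative operator $\dot L$.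
   Context: $m$ is Lebesgue measure on $[0,1]$. $L^2([0,1]^2)$ is the space of real square-integrable functions on the unit square. Integral-preserving: $\int L_\delta g\,dm=\int g\,dm$ for all $g$. $\dot k\in L^2([0,1]^2)$ is the derivative of $\delta\mapsto k_\delta$ at $\delta=0$, i.e. $k_\delta=k_0+\delta\dot k+r_\delta$ with $\|r_\delta\|_{L^2([0,1]^2)}=o(\delta)$, and $\dot L f(x):=\int\dot k(x,y)f(y)\,dy$. $L_0^*$ is the adjoint of $L_0$. $\lambda_\delta$ denotes the eigenvalue of $L_\delta$ (for small $\delta\ge0$) that depends on $\delta$ in a $C^1$ way and equals $\lambda_0$ at $\delta=0$. The eigenvectors are normalised so that $\langle e,\hat e\rangle=\int e\,\overline{\hat e}\,dm=1$.
   Formalization: The formula for the derivative is proved only for λ_0 ≠ 0 (it fails at λ_0 = 0); as the printed eigenvector condition with ⟨e,ê⟩=1 forces λ_0 real, a clause is added for L_0^*ê = conj(λ_0)ê, with the sign of the imaginary part reversed. *)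

(* Defs.v *)
From HB Require Import structures.
From mathcomp Require Import all_boot all_order all_algebra.
From mathcomp Require Import all_classical all_reals all_analysis.
From mathcomp Require Import complex.

Set Implicit Arguments.
Unset Strict Implicit.
Unset Printing Implicit Defensive.

Import Order.TTheory GRing.Theory Num.Theory.
Import numFieldNormedType.Exports.

Local Open Scope classical_set_scope.
Local Open Scope ring_scope.
Local Open Scope complex_scope.

Lemma lebesgue_unit_itv_lty (R : realType) :
  (@lebesgue_measure R `[0%R, 1%R]%classic < +oo)%E.
Proof. by rewrite lebesgue_measure_itv/= lte_fin ltr01 EFinN sube0 ltry. Qed.

(* A function on [0,1] (on [0,1]^2) is represented by a measurable function on
   the whole line (plane); only its values up to m-null (m x m-null) sets
   matter, and m charges nothing outside [0,1]. *)
Definition m01 (R : realType) :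
    {finite_measure set (measurableTypeR R) -> \bar R} :=
  @mfrestr _ (measurableTypeR R) R _ lebesgue_measure
    (measurable_itv `[0%R, 1%R]) (@lebesgue_unit_itv_lty R).

Definition m01x01 (R : realType) :
    {measure set (measurableTypeR R * measurableTypeR R) -> \bar R} :=
  (m01 R \x m01 R)%E.

Definition L2kernel (R : realType) : set (R * R -> R) :=
  [set k | k \in Lfun (m01x01 R) 2%:E].

Definition L2kernel_norm (R : realType) (k : R * R -> R) : R :=
  fine 'N[m01x01 R]_2%:E[EFin \o k].

Definition L2 (R : realType) : set (R -> R[i]) :=
  [set f | (fun x => complex.Re (f x)) \in Lfun (m01 R) 2%:E /\
           (fun x => complex.Im (f x)) \in Lfun (m01 R) 2%:E].

Definition L2norm (R : realType) (f : R -> R[i]) : R :=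
  fine 'N[m01 R]_2%:E[(fun x => (Normc.normc (f x))%:E)].

Definition cintegral (R : realType) (f : R -> R[i]) : R[i] :=
  (\int[m01 R]_x complex.Re (f x)) +i* (\int[m01 R]_x complex.Im (f x)).

Definition inner (R : realType) (f g : R -> R[i]) : R[i] :=
  cintegral (fun x => f x * (g x)^*).

Definition eq_ae (R : realType) (f g : R -> R[i]) : Prop :=
  \forall x \ae m01 R, f x = g x.

Definition integral_operator (R : realType) (k : R * R -> R)
    (f : R -> R[i]) : R -> R[i] :=
  fun x => cintegral (fun y => (k (x, y))%:C * f y).

Definition integral_preserving (R : realType)
    (L : (R -> R[i]) -> R -> R[i]) : Prop :=
  forall g, L2 g -> cintegral (L g) = cintegral g.

Definition mixing (R : realType) (L : (R -> R[i]) -> R -> R[i]) : Prop :=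
  forall g, L2 g -> cintegral g = 0 ->
    L2norm (iter n L g) @[n --> \oo] --> (0 : R).

Definition is_adjoint (R : realType)
    (L Ladj : (R -> R[i]) -> R -> R[i]) : Prop :=
  (forall g, L2 g -> L2 (Ladj g)) /\
  (forall f g, L2 f -> L2 g -> inner (L f) g = inner f (Ladj g)).

Definition eigenvector (R : realType) (L : (R -> R[i]) -> R -> R[i])
    (mu : R[i]) (f : R -> R[i]) : Prop :=
  [/\ L2 f, ~ eq_ae f (fun=> 0) & eq_ae (L f) (fun x => mu * f x)].

Definition eigenvalue (R : realType) (L : (R -> R[i]) -> R -> R[i])
    (mu : R[i]) : Prop :=
  exists f, eigenvector L mu f.

Definition geometrically_simple (R : realType)
    (L : (R -> R[i]) -> R -> R[i]) (mu : R[i]) : Prop :=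
  exists e, eigenvector L mu e /\
    forall f, eigenvector L mu f -> exists c : R[i], eq_ae f (fun x => c * e x).

Definition largest_in_open_disk (R : realType)
    (L : (R -> R[i]) -> R -> R[i]) (lam : R[i]) : Prop :=
  [/\ eigenvalue L lam, Normc.normc lam < 1 &
    forall mu, eigenvalue L mu -> Normc.normc mu < 1 ->
      Normc.normc mu <= Normc.normc lam].

(* u is C^1 from [0, b) into the space S normed by N; the derivatives are
   one-sided at 0. The membership in S matters: outside of L2kernel,
   L2kernel_norm takes the junk value fine +oo = 0. *)
Definition C1_into (R : realType) (V : lmodType R) (S : set V) (N : V -> R)
    (b : R) (u : R -> V) : Prop :=
  exists u' : R -> V,
    [/\ forall s, 0 <= s < b -> S (u s) /\ S (u' s),
        forall s, 0 <= s < b ->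
          N ((t - s)^-1 *: (u t - u s) - u' s)
            @[t --> within [set t | 0 <= t < b] s^'] --> (0 : R) &
        forall s, 0 <= s < b ->
          N (u' t - u' s)
            @[t --> within [set t | 0 <= t < b] (nbhs s)] --> (0 : R)].

Definition C1_kernel (R : realType) (b : R) (k : R -> R * R -> R) : Prop :=
  @C1_into R (R * R -> R) (@L2kernel R) (@L2kernel_norm R) b k.

(* Rcomplex R is R[i] as a vector space over R. *)
Definition C1_complex (R : realType) (b : R) (lam : R -> R[i]) : Prop :=
  @C1_into R (Rcomplex R) setT (@Normc.normc R) b lam.

Definition kernel_derivative0 (R : realType) (k : R -> R * R -> R)
    (kdot : R * R -> R) : Prop :=
  L2kernel kdot /\
  L2kernel_norm (fun z => k d z - k 0 z - d * kdot z) / d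
    @[d --> 0^'+] --> (0 : R).

Definition eigenvalue_branch (R : realType) (k : R -> R * R -> R)
    (lam0 : R[i]) (b : R) (lam : R -> R[i]) : Prop :=
  [/\ C1_complex b lam, lam 0 = lam0 &
    forall d, 0 <= d < b -> eigenvalue (integral_operator (k d)) (lam d)].

Definition double_integral (R : realType) (h : R -> R -> R) : R :=
  \int[m01 R]_x \int[m01 R]_y h x y.

(* Main.v *)
Require Import Defs.
From HB Require Import structures.
From mathcomp Require Import all_boot all_order all_algebra.
From mathcomp Require Import all_classical all_reals all_analysis.
From mathcomp Require Import measurable_realfun ring lra.
From mathcomp Require Import complex.

(* A branch of normalised eigenvectors f_d for lam d, d -> 0+, has a sequence
   along which L_0 f_d converges in L^2 (L_0 is Hilbert-Schmidt). Since
   lam0 != 0 and L_d f_d = lam d f_d, the f_d themselves converge, to a multiple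
   of e by geometric simplicity. Pairing the eigenvalue equation with a solution
   h of L_0^* h = conj(lam0) h gives
     <(L_d - L_0) f_d / d, h> = ((lam d - lam0) / d) <f_d, h>,
   and d -> 0 yields <Ldot e, h> = lamdot <e, h>.
   If instead L_0^* ehat = lam0 ehat, then lam0 is real because <e, ehat> = 1;
   applying the identity to the conjugates of e and ehat shows that lamdot is
   real, so both formulas hold. *)

Set Implicit Arguments.
Unset Strict Implicit.
Unset Printing Implicit Defensive.

Import Order.TTheory GRing.Theory Num.Theory.
Import numFieldNormedType.Exports.

Local Open Scope classical_set_scope.
Local Open Scope ring_scope.
Local Open Scope complex_scope.

(** * Real L^2 over an arbitrary measure: norm, pairing, domination *)

Section L2_real.
Context d (T : measurableType d) (R : realType).
Variable mu : {measure set T -> \bar R}.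
Implicit Types (f g : T -> R).

Local Notation L2r := (Lfun mu 2%:E).

(** The eigenvectors at different parameters are chosen independently, so d |-> f_d need not even be
    continuous, let alone differentiable. Pairing with h avoids this: the unperturbed operator moves
    onto h, the difference quotients fall on the kernel and the eigenvalue alone, and plain
    convergence of f_d is enough. One sequence d -> 0+ suffices because the C^1 branch already
    provides lamdot as a limit; only its value has to be found. The compactness of L_0 rests on weak
    convergence. A bounded sequence is tested on the indicators of countably many sets, the rays
    with rational endpoint, and an induction over L^2 extends the convergence of the pairings to all
    test functions, in particular to almost every section k(x, .). The kernels are real, so this
    analysis takes place in real L^2 and the complex statements are read off real and imaginary
    parts. A subsequence is a map s tending to infinity, not necessarily increasing. *)

Definition nm2 f : R := fine ('N[mu]_2%:E[EFin \o f])%E.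

Definition ip f g : R := \int[mu]_x (f x * g x).

Let one_le2 : (1 <= 2%:E :> \bar R)%E. Proof. by rewrite lee_fin ler1n. Qed.

Lemma Lfun2_measurable f : f \in L2r -> measurable_fun setT f.
Proof. by rewrite inE => /andP[]; rewrite !inE. Qed.

Lemma Lnorm2_sqr f : ('N[mu]_2%:E[EFin \o f] `^ 2 = \int[mu]_x (f x ^+ 2)%:E)%E.
Proof.
rewrite powR_Lnorm ?pnatr_eq0//; apply: eq_integral => x _ /=.
by rewrite powR_mulrn// -normrX ger0_norm// sqr_ge0.
Qed.

Lemma Lfun2P f : f \in L2r <->
  measurable_fun setT f /\ (\int[mu]_x (f x ^+ 2)%:E < +oo)%E.
Proof.
split=> [Hf|[mf foo]].
  split; first exact: Lfun2_measurable.
  have /integrableP[_] := Lfun2_integrable_sqr Hf.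
  by under eq_integral do rewrite /= ger0_norm ?sqr_ge0//.
rewrite inE; apply/andP; rewrite !inE; split=> //=.
by rewrite /finite_norm (@lty_poweRy _ _ 2)// ?pnatr_eq0// Lnorm2_sqr.
Qed.

Lemma nm2_ge0 f : 0 <= nm2 f.
Proof. by rewrite fine_ge0// Lnorm_ge0. Qed.

Lemma EFin_nm2 f : f \in L2r -> (nm2 f)%:E = ('N[mu]_2%:E[EFin \o f])%E.
Proof.
rewrite inE => /andP[_]; rewrite inE /= /finite_norm => Hf.
by rewrite fineK// ge0_fin_numE// Lnorm_ge0.
Qed.

Lemma nm2_sqr f : f \in L2r -> (nm2 f ^+ 2)%:E = (\int[mu]_x (f x ^+ 2)%:E)%E.
Proof.
move=> Hf; rewrite -Lnorm2_sqr -EFin_nm2// poweR_EFin.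
by rewrite powR_mulrn// nm2_ge0.
Qed.

Lemma Lfun2D f g : f \in L2r -> g \in L2r -> (fun x => f x + g x) \in L2r.
Proof. exact: (Lfun_addr_closed mu one_le2).2. Qed.

Lemma Lfun2Z a f : f \in L2r -> (fun x => a * f x) \in L2r.
Proof.
move=> Hf; rewrite (_ : (fun _ => _) = a \o* f); first exact: Lfun_scale.
by apply/funext => x /=; rewrite mulrC.
Qed.

Lemma Lfun2N f : f \in L2r -> (fun x => - f x) \in L2r.
Proof.
by move=> /(Lfun2Z (-1)); rewrite (_ : (fun _ => _) = fun x => - f x)//;
  apply/funext => x; rewrite mulN1r.
Qed.

Lemma Lfun2B f g : f \in L2r -> g \in L2r -> (fun x => f x - g x) \in L2r.
Proof. by move=> Hf Hg; apply: Lfun2D => //; exact: Lfun2N. Qed.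

Lemma nm2D f g : f \in L2r -> g \in L2r ->
  nm2 (fun x => f x + g x) <= nm2 f + nm2 g.
Proof.
move=> Hf Hg; have := @ler_LnormD _ _ _ mu _ one_le2 (Lfun_Sub one_le2 Hf)
  (Lfun_Sub one_le2 Hg); exact.
Qed.

Lemma nm2Z a f : f \in L2r -> nm2 (fun x => a * f x) = `|a| * nm2 f.
Proof.
move=> Hf; have := @LnormZ _ _ _ mu _ one_le2 (Lfun_Sub one_le2 Hf) a.
by move=> /(congr1 fine); rewrite fineM// -EFin_nm2.
Qed.

Lemma nm2N f : nm2 (fun x => - f x) = nm2 f.
Proof. by rewrite /nm2 -(oppe_Lnorm mu (EFin \o f)). Qed.

Lemma nm2B f g : f \in L2r -> g \in L2r ->
  nm2 (fun x => f x - g x) <= nm2 f + nm2 g.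
Proof. by move=> Hf Hg; rewrite -(nm2N g) nm2D// Lfun2N. Qed.

Lemma integrable_mul2 f g : f \in L2r -> g \in L2r ->
  mu.-integrable setT (EFin \o (fun x => f x * g x)).
Proof. by move=> Hf Hg; apply/Lfun1_integrable; exact: Lfun2_mul_Lfun1. Qed.

Lemma ip_le f g : f \in L2r -> g \in L2r -> `|ip f g| <= nm2 f * nm2 g.
Proof.
move=> Hf Hg; rewrite -lee_fin EFinM !EFin_nm2//.
apply: le_trans (hoelder mu (Lfun2_measurable Hf) (Lfun2_measurable Hg) _ _ _);
  rewrite ?ltr0n//; last by rewrite [RHS]splitr !div1r.
rewrite Lnorm1 /ip EFin_normr_Rintegral//; last exact: integrable_mul2.
apply: le_abse_integral => //.
exact/measurable_EFinP/measurable_funM/(Lfun2_measurable Hg)/(Lfun2_measurable Hf).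
Qed.

Lemma ipC f g : ip f g = ip g f.
Proof. by apply: eq_Rintegral => x _; rewrite mulrC. Qed.

Lemma ipDr w f g : w \in L2r -> f \in L2r -> g \in L2r ->
  ip w (fun x => f x + g x) = ip w f + ip w g.
Proof.
move=> Hw Hf Hg; rewrite /ip -RintegralD//; try exact: integrable_mul2.
by apply: eq_Rintegral => x _; rewrite mulrDr.
Qed.

Lemma ipZr a w f : w \in L2r -> f \in L2r ->
  ip w (fun x => a * f x) = a * ip w f.
Proof.
move=> Hw Hf; rewrite /ip -RintegralZl//; try exact: integrable_mul2.
by apply: eq_Rintegral => x _; rewrite mulrCA.
Qed.

Lemma ipNr w f : w \in L2r -> f \in L2r -> ip w (fun x => - f x) = - ip w f.
Proof.
move=> Hw Hf; rewrite -mulN1r -ipZr//.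
by congr (ip _ _); apply/funext => x; rewrite mulN1r.
Qed.

Lemma ipNl w f : w \in L2r -> f \in L2r -> ip (fun x => - f x) w = - ip f w.
Proof. by move=> *; rewrite ipC ipNr// ipC. Qed.

Lemma ipBr w f g : w \in L2r -> f \in L2r -> g \in L2r ->
  ip w (fun x => f x - g x) = ip w f - ip w g.
Proof.
by move=> Hw Hf Hg; rewrite ipDr ?ipNr//; exact: Lfun2N.
Qed.

Lemma ipDl w f g : w \in L2r -> f \in L2r -> g \in L2r ->
  ip (fun x => f x + g x) w = ip f w + ip g w.
Proof. by move=> *; rewrite ipC ipDr// ![ip w _]ipC. Qed.

Lemma ipZl a w f : w \in L2r -> f \in L2r ->
  ip (fun x => a * f x) w = a * ip f w.
Proof. by move=> *; rewrite ipC ipZr// ipC. Qed.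

Lemma ipBl w f g : w \in L2r -> f \in L2r -> g \in L2r ->
  ip (fun x => f x - g x) w = ip f w - ip g w.
Proof. by move=> *; rewrite ipC ipBr// ![ip w _]ipC. Qed.

Lemma eq_ae_ip w f g : w \in L2r -> f \in L2r -> g \in L2r ->
  {ae mu, forall x, f x = g x} -> ip w f = ip w g.
Proof.
move=> Hw Hf Hg fg; congr fine; apply: ae_eq_integral => //.
- exact/measurable_EFinP/measurable_funM/(Lfun2_measurable Hf)/(Lfun2_measurable Hw).
- exact/measurable_EFinP/measurable_funM/(Lfun2_measurable Hg)/(Lfun2_measurable Hw).
- by apply: filterS fg => x /= -> _.
Qed.

(** The squares compare under the integral. Domination is asked a.e. only, because the bounds on
    images of kernel operators hold where the section of the kernel is square integrable. *)
Lemma Lfun2_dom f g : measurable_fun setT f -> g \in L2r ->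
  {ae mu, forall x, `|f x| <= `|g x|} -> f \in L2r /\ nm2 f <= nm2 g.
Proof.
move=> mf Hg fg; have mg := Lfun2_measurable Hg.
have le_sqr : (\int[mu]_x (f x ^+ 2)%:E <= \int[mu]_x (g x ^+ 2)%:E)%E.
  apply: ae_ge0_le_integral => //.
  - by move=> x _; rewrite lee_fin sqr_ge0.
  - exact/measurable_EFinP/measurable_funX.
  - by move=> x _; rewrite lee_fin sqr_ge0.
  - exact/measurable_EFinP/measurable_funX.
  - apply: filterS fg => x fgx _; rewrite lee_fin.
    by rewrite -(real_normK (num_real (f x))) -(real_normK (num_real (g x)))
      lerXn2r// nnegrE.
have Hf : f \in L2r.
  by apply/Lfun2P; split=> //; have [_] := (Lfun2P g).1 Hg; apply: le_lt_trans.
split=> //; rewrite -(@ler_pXn2r _ 2)// ?nnegrE ?nm2_ge0//.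
by rewrite -lee_fin !nm2_sqr.
Qed.

Lemma eq_ae_nm2 f g : f \in L2r -> g \in L2r ->
  {ae mu, forall x, f x = g x} -> nm2 f = nm2 g.
Proof.
move=> Hf Hg fg; apply/le_anti/andP; split.
- apply: (Lfun2_dom (Lfun2_measurable Hf) Hg _).2.
  by apply: filterS fg => x ->.
- apply: (Lfun2_dom (Lfun2_measurable Hg) Hf _).2.
  by apply: filterS fg => x ->.
Qed.

Lemma nm2_eq0 f : f \in L2r -> nm2 f = 0 -> {ae mu, forall x, f x = 0}.
Proof.
move=> Hf /(@fine_Lnormr_eq0 _ _ _ mu _ one_le2 (Lfun_Sub one_le2 Hf)).
by apply: filterS => x /= /(_ I).
Qed.

(** Dominated convergence for the squares (f_n - f)^2: the limit inherits the bound h, so |f_n - f|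
    <= 2 h and 4 h^2 is an integrable majorant. *)
Lemma Lfun2_cvg_dom (f_ : nat -> T -> R) f h :
  (forall n, measurable_fun setT (f_ n)) -> measurable_fun setT f ->
  h \in L2r -> {ae mu, forall x n, `|f_ n x| <= h x} ->
  {ae mu, forall x, f_ n x @[n --> \oo] --> f x} ->
  f \in L2r /\ nm2 (fun x => f_ n x - f x) @[n --> \oo] --> (0 : R).
Proof.
move=> mf_ mf Hh fh ff.
have dom_f : {ae mu, forall x, `|f x| <= h x}.
  apply: filterS2 fh ff => x fhx /cvg_norm ffx.
  by apply: (cvgr_to_le ffx); exact: nearW.
have Hf : f \in L2r.
  apply: (Lfun2_dom mf Hh _).1.
  by apply: filterS dom_f => x /le_trans; apply; exact: ler_norm.
have Hf_ n : f_ n \in L2r.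
  apply: (Lfun2_dom (mf_ n) Hh _).1.
  by apply: filterS fh => x /(_ n)/le_trans; apply; exact: ler_norm.
split=> //.
pose s n := fun x => ((f_ n x - f x) ^+ 2)%:E.
have [] := @dominated_convergence _ T R mu setT measurableT s (cst 0%E)
  (fun x => (4 * h x ^+ 2)%:E).
- move=> n; apply/measurable_EFinP/measurable_funX.
  exact: measurable_funB.
- exact: measurable_cst.
- apply: filterS ff => x ffx _; rewrite /cst.
  rewrite (_ : 0%E = ((f x - f x) ^+ 2)%:E); last by rewrite subrr expr0n.
  apply: cvg_EFin; first exact: nearW.
  by apply: cvgM; apply: cvgB => //; exact: cvg_cst.
- under eq_fun do rewrite EFinM.
  apply: integrableZl => //; exact: Lfun2_integrable_sqr.
- apply: filterS2 fh dom_f => x fhx fx n _.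
  rewrite /s /= lee_fin ger0_norm ?sqr_ge0//.
  rewrite (_ : 4 * h x ^+ 2 = (h x + h x) ^+ 2); last by ring.
  rewrite -(real_normK (num_real (f_ n x - f x))) lerXn2r ?nnegrE//.
    by rewrite addr_ge0// (le_trans _ fx).
  by rewrite (le_trans (ler_normB _ _))// lerD.
move=> _ + _.
under eq_fun do under eq_integral do rewrite sube0 gee0_abs ?lee_fin ?sqr_ge0//.
move=> s0.
have sqr0 : (nm2 (fun x => f_ n x - f x) ^+ 2) @[n --> \oo] --> (0 : R).
  have : (nm2 (fun x => f_ n x - f x) ^+ 2)%:E @[n --> \oo] --> 0%E.
    rewrite (_ : (fun _ => _) = fun n => \int[mu]_x s n x)%E//.
    by apply/funext => n; rewrite nm2_sqr//; exact: Lfun2B.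
  by move/fine_cvgP => [].
have := cvg_comp _ _ sqr0 (@sqrt_continuous R 0); rewrite sqrtr0.
apply: cvg_trans; apply: near_eq_cvg; apply: nearW => n /=.
by rewrite sqrtr_sqr ger0_norm ?nm2_ge0.
Qed.

End L2_real.

(** * Hilbert-Schmidt operators between real L^2 spaces *)

Section integral_operators.
Context d1 d2 (T1 : measurableType d1) (T2 : measurableType d2) (R : realType).
Variable m1 : {finite_measure set T1 -> \bar R}.
Variable m2 : {finite_measure set T2 -> \bar R}.
Implicit Types (k : T1 * T2 -> R) (u : T2 -> R).

Local Notation L2k := (Lfun (m1 \x m2)%E 2%:E).
Local Notation nmk := (nm2 (m1 \x m2)%E).

Definition iop k u : T1 -> R := fun x => \int[m2]_y (k (x, y) * u y).

(** Fubini for the integrable function k^2. *)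
Lemma ae_section k : k \in L2k ->
  {ae m1, forall x, (fun y => k (x, y)) \in Lfun m2 2%:E}.
Proof.
move=> Hk; have mk := Lfun2_measurable Hk.
apply: filterS (ae_integrable1 (Lfun2_integrable_sqr Hk)) => x /integrableP[_].
under eq_integral do rewrite /= ger0_norm ?sqr_ge0//.
by move=> koo; apply/Lfun2P; split=> //; apply: measurableT_comp.
Qed.

Definition section_norm k : T1 -> R := fun x => nm2 m2 (fun y => k (x, y)).

Lemma section_norm_L2 k : k \in L2k ->
  section_norm k \in Lfun m1 2%:E /\ nm2 m1 (section_norm k) = nmk k.
Proof.
move=> Hk; have mk := Lfun2_measurable Hk.
pose F x := (\int[m2]_y (k (x, y) ^+ 2)%:E)%E.
have mk2 : measurable_fun setT (fun z => (k z ^+ 2)%:E).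
  exact/measurable_EFinP/measurable_funX.
have mF : measurable_fun setT F.
  apply: (measurable_fun_fubini_tonelli_F (fun z => (k z ^+ 2)%:E)) => //.
  by move=> z; rewrite lee_fin sqr_ge0.
have intF : (\int[m1]_x F x = \int[(m1 \x m2)%E]_z (k z ^+ 2)%:E)%E.
  by rewrite fubini_tonelli1// => z; rewrite lee_fin sqr_ge0.
have mN : measurable_fun setT (section_norm k).
  (* This closed form holds at every x, even where the section is not square integrable, and so
     yields measurability. *)
  rewrite (_ : section_norm k = fine \o (fun x => F x `^ 2^-1)%E).
    apply: (measurableT_comp (fine_measurable measurableT)).
    exact: (measurableT_comp (measurable_poweR _)).
  apply/funext => x /=; congr fine; rewrite unlock; congr (_ `^ _)%E.
  apply: eq_integral => y _ /=.
  by rewrite powR_mulrn// -normrX ger0_norm// sqr_ge0.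
(* Only a.e.: where F x = +oo, [fine] sends the norm of the section to 0. *)
have sqrN : {ae m1, forall x, setT x -> ((section_norm k x) ^+ 2)%:E = F x}.
  by apply: filterS (ae_section Hk) => x Hkx _; exact: nm2_sqr.
have intN : (\int[m1]_x (section_norm k x ^+ 2)%:E = (nmk k ^+ 2)%:E)%E.
  rewrite nm2_sqr// -intF; apply: ge0_ae_eq_integral => //.
  - exact/measurable_EFinP/measurable_funX.
  - by move=> x _; rewrite lee_fin sqr_ge0.
  - by move=> x _; apply: integral_ge0 => y _; rewrite lee_fin sqr_ge0.
have HN : section_norm k \in Lfun m1 2%:E.
  by apply/Lfun2P; split=> //; rewrite intN ltry.
split=> //; apply: (@pexpIrn _ 2); rewrite ?nnegrE ?nm2_ge0//.
by apply: EFin_inj; rewrite -intN nm2_sqr.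
Qed.

Lemma Lfun2_tensor w u : w \in Lfun m1 2%:E -> u \in Lfun m2 2%:E ->
  (fun z : T1 * T2 => w z.1 * u z.2) \in L2k.
Proof.
move=> Hw Hu; have mw := Lfun2_measurable Hw; have mu2 := Lfun2_measurable Hu.
have mwu : measurable_fun setT (fun z : T1 * T2 => w z.1 * u z.2).
  by apply: measurable_funM; exact: measurableT_comp.
apply/Lfun2P; split=> //.
rewrite fubini_tonelli1//; last 2 first.
- exact/measurable_EFinP/measurable_funX.
- by move=> z; rewrite lee_fin sqr_ge0.
rewrite (_ : fubini_F _ _ = fun x => ((nm2 m2 u ^+ 2)%:E * (w x ^+ 2)%:E)%E).
  rewrite ge0_integralZl//.
  - by rewrite -!nm2_sqr// -EFinM ltry.
  - exact/measurable_EFinP/measurable_funX.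
  - by move=> x _; rewrite lee_fin sqr_ge0.
  - by rewrite lee_fin sqr_ge0.
apply/funext => x; rewrite /fubini_F nm2_sqr// muleC -ge0_integralZl//.
- by apply: eq_integral => y _; rewrite exprMn EFinM.
- exact/measurable_EFinP/measurable_funX.
- by move=> y _; rewrite lee_fin sqr_ge0.
- by rewrite lee_fin sqr_ge0.
Qed.

(** Read as 1 * u(y), the function u lies in L^2 of the product because m1 is finite. Hence k u is
    integrable there, and Fubini makes its partial integral measurable. *)
Lemma measurable_iop k u : k \in L2k -> u \in Lfun m2 2%:E ->
  measurable_fun setT (iop k u).
Proof.
move=> Hk Hu; have := Lfun2_tensor (Lfun_cst m1 1 2) Hu.
under eq_fun do rewrite mul1r.
move=> Hu2; apply: (measurableT_comp (fine_measurable measurableT)).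
exact: (measurable_fubini_F (integrable_mul2 Hk Hu2)).
Qed.

(** Cauchy-Schwarz in y on each square integrable section. *)
Lemma iop_dom k u : k \in L2k -> u \in Lfun m2 2%:E ->
  {ae m1, forall x, `|iop k u x| <= nm2 m2 u * section_norm k x}.
Proof.
move=> Hk Hu; apply: filterS (ae_section Hk) => x Hkx.
by rewrite mulrC; exact: ip_le.
Qed.

Lemma iop_L2 k u : k \in L2k -> u \in Lfun m2 2%:E -> iop k u \in Lfun m1 2%:E.
Proof.
move=> Hk Hu; have [HN _] := section_norm_L2 Hk.
apply: (Lfun2_dom (measurable_iop Hk Hu) (Lfun2Z (nm2 m2 u) HN) _).1.
by apply: filterS (iop_dom Hk Hu) => x /le_trans; apply; exact: ler_norm.
Qed.

(** The Hilbert-Schmidt bound: the image is dominated by a multiple of [section_norm k], whose norm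
    is that of k. *)
Lemma nm2_iop k u : k \in L2k -> u \in Lfun m2 2%:E ->
  nm2 m1 (iop k u) <= nmk k * nm2 m2 u.
Proof.
move=> Hk Hu; have [HN <-] := section_norm_L2 Hk.
rewrite mulrC -[X in X * _]ger0_norm ?nm2_ge0// -nm2Z//.
apply: (Lfun2_dom (measurable_iop Hk Hu) (Lfun2Z (nm2 m2 u) HN) _).2.
by apply: filterS (iop_dom Hk Hu) => x /le_trans; apply; exact: ler_norm.
Qed.

(** Linearity is claimed a.e. because the integrals are split on square integrable sections, where
    the products are integrable. *)
Lemma iopDr k u v : k \in L2k -> u \in Lfun m2 2%:E -> v \in Lfun m2 2%:E ->
  {ae m1, forall x, iop k (fun y => u y + v y) x = iop k u x + iop k v x}.
Proof.
by move=> Hk Hu Hv; apply: filterS (ae_section Hk) => x Hkx; exact: ipDr.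
Qed.

Lemma iopZr a k u : k \in L2k -> u \in Lfun m2 2%:E ->
  {ae m1, forall x, iop k (fun y => a * u y) x = a * iop k u x}.
Proof.
by move=> Hk Hu; apply: filterS (ae_section Hk) => x Hkx; exact: ipZr.
Qed.

Lemma iopBr k u v : k \in L2k -> u \in Lfun m2 2%:E -> v \in Lfun m2 2%:E ->
  {ae m1, forall x, iop k (fun y => u y - v y) x = iop k u x - iop k v x}.
Proof.
by move=> Hk Hu Hv; apply: filterS (ae_section Hk) => x Hkx; exact: ipBr.
Qed.

Lemma iopBl k l u : k \in L2k -> l \in L2k -> u \in Lfun m2 2%:E ->
  {ae m1, forall x, iop (fun z => k z - l z) u x = iop k u x - iop l u x}.
Proof.
move=> Hk Hl Hu; apply: filterS2 (ae_section Hk) (ae_section Hl) => x Hkx Hlx.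
by rewrite [LHS]ipC [RHS](congr2 +%R (ipC _ _ _) (congr1 -%R (ipC _ _ _))) ipBr.
Qed.

Lemma iopZl a k u : k \in L2k -> u \in Lfun m2 2%:E ->
  {ae m1, forall x, iop (fun z => a * k z) u x = a * iop k u x}.
Proof.
move=> Hk Hu; apply: filterS (ae_section Hk) => x Hkx.
by rewrite [LHS]ipC [iop k u x]ipC ipZr.
Qed.

Lemma eq_ae_iop k u v : k \in L2k -> u \in Lfun m2 2%:E -> v \in Lfun m2 2%:E ->
  {ae m2, forall x, u x = v x} -> {ae m1, forall x, iop k u x = iop k v x}.
Proof.
by move=> Hk Hu Hv uv; apply: filterS (ae_section Hk) => x Hkx; exact: eq_ae_ip.
Qed.

End integral_operators.

(** * Extraction and completeness for real sequences *)

Section sequences.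
Context (R : realType).

(* Along an ultrafilter refining \oo all the rows [a j] converge at once; [s m]
   is picked among the indices where the first m rows are 1/(m+1)-close to
   their limits. *)
Lemma diagonal_extraction (a : nat -> nat -> R) (M : R) :
  (forall j n, `|a j n| <= M) ->
  exists s : nat -> nat, s n @[n --> \oo] --> \oo /\
    forall j, cvgn (fun n => a j (s n)).
Proof.
move=> aM; have [G [GU sG]] := ultraFilterLemma (eventually_filter).
have lim_a j : exists l : R, a j n @[n --> G] --> l.
  have [|l [_ al]] := @segment_compact R (- M) M (a j @ G) _.
    by apply: nearW => n /=; rewrite in_itv/= -ler_norml.
  exists l => V nV; have [//|GnV] := in_ultra_setVsetC (a j @^-1` V) GU.
  by have [y []] := al (~` V) V GnV nV.
have [l al] := choice lim_a.
pose good m n := (m <= n)%N /\ forall j, (j <= m)%N -> `|l j - a j n| < m.+1%:R^-1.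
have ex_good m : exists n, good m n.
  apply: (@filter_ex _ G); apply: filterI.
    by apply: sG; exists m.
  have : forall k, G [set n | forall j, (j < k)%N -> `|l j - a j n| < m.+1%:R^-1].
    elim=> [|k IH]; first by apply: nearW.
    have mV0 : 0 < m.+1%:R^-1 :> R by rewrite invr_gt0.
    have /cvgrPdist_lt/(_ _ mV0) Hk := al k.
    apply: filterS2 IH Hk => n IH Hk j; rewrite ltnS leq_eqVlt.
    by move=> /predU1P[->//|/IH].
  by move=> /(_ m.+1).
have [s Hs] := choice ex_good; exists s; split.
  move=> V [N _ NV]; exists N => // n Nn; apply: NV => /=.
  exact: leq_trans (Hs n).1.
move=> j; apply/cvg_ex; exists (l j); apply/cvgrPdist_lt => e e0.
near=> n; apply: lt_trans ((Hs n).2 j _) _; first by near: n; exact: nbhs_infty_ge.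
by near: n; exact: near_infty_natSinv_lt (PosNum e0).
Unshelve. all: by end_near. Qed.

(** Once y is within e/2 of its limit, x stays in the e-ball around [limn y], so x is Cauchy. This
    carries convergence of pairings through L^2 limits of test functions. *)
Lemma cvgn_uniform_approx (x : nat -> R) :
  (forall e : R, 0 < e -> exists2 y : nat -> R, cvgn y & forall n, `|x n - y n| <= e) ->
  cvgn x.
Proof.
move=> Hx; apply/cauchy_cvgP/cauchyP => e e0.
have e20 : 0 < e / 2 by rewrite divr_gt0.
have [y cy xy] := Hx _ e20; exists (limn y).
have /cvgrPdist_lt/(_ _ e20) : y n @[n --> \oo] --> limn y by [].
rewrite /nbhs/= /nbhs/=; apply: filterS => n yn.
rewrite /ball/= (splitr e) (le_lt_trans (ler_distD (y n) _ _))//.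
by rewrite ltr_leD// distrC.
Qed.

End sequences.

(** * Induction over L^2 from a generating pi-system, and weak compactness *)

Section L2_induction.
Context d (T : measurableType d) (R : realType).
Variable mu : {finite_measure set T -> \bar R}.
Local Notation L2r := (Lfun mu 2%:E).

Lemma indic_Lfun2 A : measurable A -> (\1_A : T -> R) \in L2r.
Proof.
move=> mA; apply: (Lfun2_dom _ (Lfun_cst mu 1 2) _).1 => //.
by apply: nearW => x; rewrite /= indicE normr1; case: (_ \in _); rewrite ?normr1 ?normr0.
Qed.

Variables (G : set (set T)) (P : (T -> R) -> Prop).
Hypothesis measurable_gen : @measurable _ T = <<s G>>.
Hypothesis setI_G : setI_closed G.
Hypothesis P1 : P (\1_setT).
Hypothesis PG : forall A, G A -> P (\1_A).
Hypothesis PD : forall f g, f \in L2r -> g \in L2r -> P f -> P g ->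
  P (fun x => f x + g x).
Hypothesis PZ : forall a f, f \in L2r -> P f -> P (fun x => a * f x).
Hypothesis Plim : forall (f_ : nat -> T -> R) f, (forall n, f_ n \in L2r) ->
  f \in L2r -> nm2 mu (fun x => f_ n x - f x) @[n --> \oo] --> (0 : R) ->
  (forall n, P (f_ n)) -> P f.

(** Dynkin's pi-lambda theorem. Proper differences are handled by 1_(B \ C) = 1_B - 1_C for C
    included in B, increasing unions by L^2 limits of indicators, all dominated by 1. *)
Let P_indic A : measurable A -> P (\1_A).
Proof.
move=> mA; suff : <<s G>> `<=` [set B | measurable B /\ P \1_B].
  by rewrite -measurable_gen => /(_ A mA)[].
apply: lambda_system_subset => //; last first.
  by move=> B GB; split; [rewrite measurable_gen; exact: sub_gen_smallest|exact: PG].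
split=> //.
- move=> B C CB [mB PB] [mC PC]; split; first exact: measurableD.
  rewrite (_ : \1_(B `\` C) = fun x => \1_B x + (-1) * \1_C x :> R).
    apply: (@PD \1_B) => //; first exact: indic_Lfun2.
      exact/Lfun2Z/indic_Lfun2.
    by apply: (@PZ _ \1_C) => //; exact: indic_Lfun2.
  apply/funext => x; rewrite !indicE in_setD.
  have [/set_mem/CB/mem_set ->|] := boolP (x \in C); rewrite ?andbT ?andbF/=.
    by rewrite mulr1 subrr.
  by rewrite mulr0 addr0.
- move=> F ndF HF; have mF n : measurable (F n) by have [] := HF n.
  have mU : measurable (\bigcup_n F n) by exact: bigcup_measurable.
  split=> //; apply: (@Plim (fun n => \1_(F n))).
  + by move=> n; exact: indic_Lfun2.
  + exact: indic_Lfun2.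
  + apply: (Lfun2_cvg_dom _ _ (Lfun_cst mu 1 2) _ _).2.
    - by move=> n; exact: measurable_indic.
    - exact: measurable_indic.
    - apply: nearW => x n /=; rewrite indicE.
      by case: (_ \in _); rewrite ?normr1 ?normr0.
    apply: nearW => x; apply: cvg_near_cst.
    have [[N _ FNx]|nFx] := pselect ((\bigcup_n F n) x).
      exists N => // n /= Nn; rewrite !indicE !mem_set//; first by exists N.
      by move: FNx; apply/subsetPset/ndF.
    apply: nearW => n; rewrite !indicE !memNset// => Fnx.
    by apply: nFx; exists n.
  + by move=> n; have [] := HF n.
Qed.

Let P_sum n (c : nat -> R) (A : nat -> set T) : (forall i, measurable (A i)) ->
  P (fun x => \sum_(i < n) c i * \1_(A i) x) /\
  (fun x => \sum_(i < n) c i * \1_(A i) x) \in L2r.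
Proof.
move=> mA; elim: n => [|n [IHP IHL]].
  rewrite (_ : (fun _ => _) = fun x => 0 * \1_setT x); last first.
    by apply/funext => x; rewrite big_ord0 mul0r.
  split; first by apply: (@PZ _ \1_setT) => //; exact: indic_Lfun2.
  exact/Lfun2Z/indic_Lfun2.
rewrite (_ : (fun _ => _) =
  fun x => (\sum_(i < n) c i * \1_(A i) x) + c n * \1_(A n) x); last first.
  by apply/funext => x; rewrite big_ord_recr.
have HA : (fun x => c n * \1_(A n) x) \in L2r by exact/Lfun2Z/indic_Lfun2.
split; last exact: Lfun2D.
by apply: PD => //; apply: (@PZ _ \1_(A n)); [exact: indic_Lfun2|exact: P_indic].
Qed.

Import HBNNSimple.

Let P_nnsfun (f : {nnsfun T >-> R}) : P f.
Proof.
rewrite (funext (fimfunEord f)); set s := fset_set _.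
have mf i : measurable (f @^-1` [set nth 0 (finmap.enum_fset s) i]) by [].
exact: (P_sum _ (nth 0 (finmap.enum_fset s)) mf).1.
Qed.

(** The simple functions that approximate f from below are dominated by f itself, so their pointwise
    convergence is convergence in L^2. *)
Let P_ge0 f : f \in L2r -> (forall x, 0 <= f x) -> P f.
Proof.
move=> Hf f0; have mf := Lfun2_measurable Hf.
have mEf : measurable_fun setT (EFin \o f) by exact/measurable_EFinP.
pose g := nnsfun_approx measurableT mEf.
have g_le n x : g n x <= f x.
  rewrite -lee_fin /g nnsfun_approxE; apply: le_approx => // y _.
  by rewrite lee_fin.
have dom_g : {ae mu, forall x n, `|g n x| <= f x}.
  by apply: nearW => x n; rewrite ger0_norm.
apply: (@Plim (fun n => g n)) => //.
- move=> n; apply: (Lfun2_dom _ Hf _).1 => //; apply: nearW => x.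
  by rewrite !ger0_norm.
- apply: (Lfun2_cvg_dom _ _ Hf _ _).2 => //.
  apply: nearW => x; have := @cvg_nnsfun_approx _ _ _ _ measurableT _ mEf _ x I.
  by move=> /(_ (fun y _ => f0 y)) /fine_cvgP[].
Qed.

(** A functional monotone class theorem; the last step splits f into positive and negative parts. *)
Lemma Lfun2_ind f : f \in L2r -> P f.
Proof.
move=> Hf; have mf := Lfun2_measurable Hf.
have mmax (g : T -> R) : g \in L2r -> (fun x => Num.max (g x) 0) \in L2r.
  move=> Hg; apply: (Lfun2_dom _ Hg _).1.
    exact: measurable_maxr (Lfun2_measurable Hg) (measurable_cst _).
  apply: nearW => x; rewrite ger0_norm ?le_max ?lexx ?orbT//.
  by rewrite ge_max ler_norm normr_ge0.
have Hf1 := mmax _ Hf; have Hf2 := mmax _ (Lfun2N Hf).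
rewrite (_ : f = fun x => Num.max (f x) 0 + (-1) * Num.max (- f x) 0).
  apply: PD => //; first exact: Lfun2Z.
    by apply: P_ge0 => // x; rewrite le_max lexx orbT.
  by apply: PZ => //; apply: P_ge0 => // x; rewrite le_max lexx orbT.
apply/funext => x; have [f0|f0] := leP 0 (f x).
  by rewrite max_r ?oppr_le0// mulr0 addr0.
by rewrite max_l ?oppr_ge0 ?(ltW f0)// mulN1r opprK add0r.
Qed.

End L2_induction.

(** Diagonal extraction handles the countably many indicators of the [A j]; the functions whose
    pairings converge are stable under linear combinations and L^2 limits, so induction reaches all
    of L^2. The conclusion is convergence of every pairing, without naming a weak limit: this is the
    form used on sections of a kernel. *)
Lemma weak_sequential_compactness d (T : measurableType d) (R : realType)
    (mu : {finite_measure set T -> \bar R}) (A : nat -> set T)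
    (u : nat -> T -> R) (C : R) :
  @measurable _ T = <<s range A>> -> setI_closed (range A) ->
  (forall n, u n \in Lfun mu 2%:E) -> (forall n, nm2 mu (u n) <= C) ->
  exists s : nat -> nat, s n @[n --> \oo] --> \oo /\
    forall g, g \in Lfun mu 2%:E -> cvgn (fun n => ip mu g (u (s n))).
Proof.
move=> genA setIA Hu uC.
have C0 : 0 <= C by rewrite (le_trans (nm2_ge0 _ _) (uC 0%N)).
have mA j : measurable (A j) by rewrite genA; apply: sub_gen_smallest; exists j.
(* The whole space is put in front: the induction also starts from its indicator, which need not
   come from [range A]. *)
pose B j := if j is j'.+1 then A j' else setT.
have mB j : measurable (B j) by case: j => [|j] /=.
have ip_bound g n : g \in Lfun mu 2%:E -> `|ip mu g (u n)| <= nm2 mu g * C.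
  by move=> Hg; rewrite (le_trans (ip_le _ _))// ler_wpM2l// nm2_ge0.
(* The extraction wants one bound for all rows: the norm of an indicator is at most that of the
   constant 1. *)
have [j n|s [soo cvgs]] :=
    @diagonal_extraction R (fun j n => ip mu \1_(B j) (u n)) (nm2 mu (cst 1) * C).
  apply: le_trans (ip_bound _ _ (indic_Lfun2 _ (mB j))) _.
  rewrite ler_wpM2r//; apply: (Lfun2_dom _ (Lfun_cst mu 1 2) _).2 => //.
  by apply: nearW => x; rewrite /= indicE; case: (_ \in _); rewrite ?normr1 ?normr0.
exists s; split=> // g; apply: (@Lfun2_ind _ _ _ _ (range A)
  (fun g => cvgn (fun n => ip mu g (u (s n))))) => //.
- exact: (cvgs 0%N).
- by move=> _ [j _ <-]; exact: (cvgs j.+1).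
- move=> f h Hf Hh cf ch.
  rewrite (_ : (fun _ => _) = fun n => ip mu f (u (s n)) + ip mu h (u (s n))).
    exact: is_cvgD.
  by apply/funext => n; rewrite ipC ipDr// ![ip mu (u _) _]ipC.
- move=> a f Hf cf.
  rewrite (_ : (fun _ => _) = fun n => a * ip mu f (u (s n))).
    exact: is_cvgMr.
  by apply/funext => n; rewrite ipC ipZr// ipC.
- move=> f_ f Hf_ Hf ff cf_; apply: cvgn_uniform_approx => e e0.
  (* C + 1 stays positive when C = 0. A single [f_ N] this close to f moves all the pairings with u
     by at most e, uniformly in n. *)
  have eC0 : 0 < e / (C + 1) by rewrite divr_gt0// ltr_wpDl.
  have /cvgr0Pnorm_lt/(_ _ eC0)[N _ /(_ N (leqnn N))] := ff.
  rewrite /= ger0_norm ?nm2_ge0// => fNe.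
  exists (fun n => ip mu (f_ N) (u (s n))) => // n.
  rewrite distrC ipC [ip mu f _]ipC -ipBr// ipC.
  apply: le_trans (ip_bound _ _ (Lfun2B (Hf_ N) Hf)) _.
  apply: (@le_trans _ _ (e / (C + 1) * (C + 1))); last by rewrite divfK// gt_eqF// ltr_wpDl.
  by apply: ler_pM => //; [exact: nm2_ge0|exact: ltW|rewrite lerDl].
Qed.

(** * Compactness of Hilbert-Schmidt operators *)

Section compactness.
Context d1 d2 (T1 : measurableType d1) (T2 : measurableType d2) (R : realType).
Variable m1 : {finite_measure set T1 -> \bar R}.
Variable m2 : {finite_measure set T2 -> \bar R}.

(* A weakly convergent subsequence of [u] is mapped to an a.e. convergent
   sequence dominated by [C * section_norm m2 k], which converges in L^2. *)
Lemma iop_compact (A : nat -> set T2) (k : T1 * T2 -> R)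
    (u : nat -> T2 -> R) (C : R) :
  @measurable _ T2 = <<s range A>> -> setI_closed (range A) ->
  k \in Lfun (m1 \x m2)%E 2%:E ->
  (forall n, u n \in Lfun m2 2%:E) -> (forall n, nm2 m2 (u n) <= C) ->
  exists s : nat -> nat, s n @[n --> \oo] --> \oo /\
    exists2 U, U \in Lfun m1 2%:E &
      nm2 m1 (fun x => iop m2 k (u (s n)) x - U x) @[n --> \oo] --> (0 : R).
Proof.
move=> genA setIA Hk Hu uC; have [HN _] := section_norm_L2 Hk.
have [s [soo cvgs]] := weak_sequential_compactness genA setIA Hu uC.
exists s; split=> //.
(* A limsup is measurable whether or not the sequence converges at x, and it is the limit at almost
   every x. *)
pose U x := fine (limn_esup (fun n => (iop m2 k (u (s n)) x)%:E)).
have mk n : measurable_fun setT (iop m2 k (u (s n))) := measurable_iop Hk (Hu _).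
have mU : measurable_fun setT U.
  apply: (measurableT_comp (fine_measurable measurableT)).
  apply: (@measurable_fun_limn_esup _ _ _ setT (fun n x => (iop m2 k (u (s n)) x)%:E)) => n.
  exact/measurable_EFinP/mk.
have [||HU cU] := @Lfun2_cvg_dom _ _ _ m1 (fun n => iop m2 k (u (s n))) U
  (fun x => C * section_norm m2 k x) mk mU (Lfun2Z C HN).
- have : {ae m1, forall x, forall n,
      `|iop m2 k (u (s n)) x| <= nm2 m2 (u (s n)) * section_norm m2 k x}.
    by apply/ae_foralln => n; exact: iop_dom.
  apply: filterS => x Hx n; apply: le_trans (Hx n) _.
  by rewrite ler_wpM2r// nm2_ge0.
(* For almost every x the section k(x, .) is an L^2 test function, and the image at x is its pairing
   with u. *)
- apply: filterS (ae_section Hk) => x /cvgs cx.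
  have cE : (iop m2 k (u (s n)) x)%:E @[n --> \oo] -->
      (limn (fun n => iop m2 k (u (s n)) x))%:E.
    by apply: cvg_EFin; [exact: nearW|exact: cx].
  rewrite /U is_cvg_limn_esupE//=; last by apply/cvg_ex; eexists; exact: cE.
  by rewrite (cvg_lim _ cE).
- by exists U.
Qed.

End compactness.

(** The rays ]q, +oo[ with q rational: two of them meet in the ray at the larger endpoint, and
    density of the rationals recovers all real endpoints. *)
Lemma measurableTypeR_rays (R : realType) :
  exists2 A : nat -> set (measurableTypeR R),
    @measurable _ (measurableTypeR R) = <<s range A>> & setI_closed (range A).
Proof.
pose q n : rat := odflt 0 (unpickle n).
have qK (r : rat) : exists n, q n = r by exists (pickle r); rewrite /q pickleK.
pose A n : set (measurableTypeR R) := `]ratr (q n), +oo[%classic.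
have salg := smallest_sigma_algebra setT (range A).
exists A.
  rewrite [LHS](RGenOInfty.measurableE R); apply/seteqP; split.
    apply: smallest_sub => // _ [x ->].
    (* The union runs over all codes n; rationals below x contribute the empty set. *)
    rewrite (_ : `]x, +oo[%classic = \bigcup_n
        (if x <= ratr (q n) then A n else set0)); last first.
      apply/seteqP; split=> [y /=|y [n _]].
        rewrite in_itv/= andbT => xy; have [r] := rat_in_itvoo xy.
        rewrite in_itv/= => /andP[xr ry]; have [n qn] := qK r.
        by exists n => //; rewrite qn ltW// /A /= qn in_itv/= andbT.
      case: ifPn => // xq; rewrite /A /= !in_itv/= !andbT.
      exact: le_lt_trans.
    case: salg => s0 _; apply => n; case: ifP => // _.
    by apply: sub_gen_smallest; exists n.
  apply: smallest_sub; first exact: smallest_sigma_algebra.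
  by move=> _ [n _ <-]; apply: sub_gen_smallest; exists (ratr (q n)).
move=> _ _ [m _ <-] [n _ <-]; have [k qk] := qK (Num.max (q m) (q n)).
exists k => //; rewrite /A qk.
have -> : ratr (Num.max (q m) (q n)) = Num.max (ratr (q m)) (ratr (q n)) :> R.
  by rewrite !maxEle ler_rat; case: ifP.
by apply/seteqP; split=> x /=; rewrite !in_itv/= !andbT gt_max => /andP.
Qed.

(** * Real and imaginary parts of complex numbers and sequences *)

Section complex_parts.
Context (R : realType).
Implicit Types a b : R[i].

Lemma complexP a b :
  complex.Re a = complex.Re b -> complex.Im a = complex.Im b -> a = b.
Proof. by case: a b => [? ?] [? ?] /= -> ->. Qed.

Lemma Re_mulc a b : complex.Re (a * b) =
  complex.Re a * complex.Re b - complex.Im a * complex.Im b.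
Proof. by case: a b => [? ?] [? ?]. Qed.

Lemma Im_mulc a b : complex.Im (a * b) =
  complex.Re a * complex.Im b + complex.Im a * complex.Re b.
Proof. by case: a b => [? ?] [? ?]. Qed.

Lemma Re_subc a b : complex.Re (a - b) = complex.Re a - complex.Re b.
Proof. by case: a b => [? ?] [? ?]. Qed.

Lemma Im_subc a b : complex.Im (a - b) = complex.Im a - complex.Im b.
Proof. by case: a b => [? ?] [? ?]. Qed.

Lemma Re_le_normc a : `|complex.Re a| <= Normc.normc a.
Proof.
by case: a => x y /=; rewrite -sqrtr_sqr ler_wsqrtr// lerDl sqr_ge0.
Qed.

Lemma Im_le_normc a : `|complex.Im a| <= Normc.normc a.
Proof.
by case: a => x y /=; rewrite -sqrtr_sqr ler_wsqrtr// lerDr sqr_ge0.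
Qed.

(** Convergence by parts, so that every limit is computed in R. *)
Definition ccvg (z : nat -> R[i]) (l : R[i]) : Prop :=
  complex.Re (z n) @[n --> \oo] --> complex.Re l /\
  complex.Im (z n) @[n --> \oo] --> complex.Im l.

Lemma ccvgM z w l m : ccvg z l -> ccvg w m -> ccvg (fun n => z n * w n) (l * m).
Proof.
move=> [zr zi] [wr wi]; split.
- by rewrite Re_mulc; under eq_fun do rewrite Re_mulc; apply: cvgB; apply: cvgM.
- by rewrite Im_mulc; under eq_fun do rewrite Im_mulc; apply: cvgD; apply: cvgM.
Qed.

Lemma ccvg_unique z l m : ccvg z l -> ccvg z m -> l = m.
Proof.
move=> [zr zi] [wr wi]; apply: complexP.
- exact: (cvg_unique _ zr wr).
- exact: (cvg_unique _ zi wi).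
Qed.

Lemma ccvg_sub z l s : s n @[n --> \oo] --> \oo ->
  ccvg z l -> ccvg (fun n => z (s n)) l.
Proof.
by move=> soo [zr zi]; split; [exact: cvg_comp soo zr|exact: cvg_comp soo zi].
Qed.

End complex_parts.

(* The library's instances are not found automatically for [m01 R]. *)
#[local] Instance ae_m01_filter (R : realType) :
  Filter (almost_everywhere (m01 R)).
Proof. exact: (@ae_filter_ringOfSetsType _ _ _ (m01 R)). Qed.

#[local] Instance nbhs_ae_m01_filter (R : realType) :
  Filter (nbhs (almost_everywhere (m01 R))).
Proof. exact: ae_m01_filter. Qed.

(** * Complex L^2 on the unit interval, by parts *)

Section L2_complex.
Context (R : realType).
Local Notation mu := (m01 R).
Local Notation L2r := (Lfun mu 2%:E).
Local Notation L2k := (Lfun (m01x01 R) 2%:E).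
Local Notation nmk := (nm2 (m01x01 R)).
Local Notation Re := complex.Re.
Local Notation Im := complex.Im.
Implicit Types (f g h : R -> R[i]) (c : R[i]) (k l : R * R -> R).

Definition re f : R -> R := fun x => Re (f x).
Definition im f : R -> R := fun x => Im (f x).

(* Equivalent to the usual norm of L^2([0,1], C), and cheaper to handle. *)
Definition nmC f : R := nm2 mu (re f) + nm2 mu (im f).

Lemma nmC_ge0 f : 0 <= nmC f. Proof. by rewrite addr_ge0 ?nm2_ge0. Qed.

Lemma reZ c f : re (fun x => c * f x) = fun x => Re c * re f x - Im c * im f x.
Proof. by apply/funext => x; rewrite /re Re_mulc. Qed.

Lemma imZ c f : im (fun x => c * f x) = fun x => Re c * im f x + Im c * re f x.
Proof. by apply/funext => x; rewrite /im Im_mulc. Qed.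

Lemma reB f g : re (fun x => f x - g x) = fun x => re f x - re g x.
Proof. by apply/funext => x; rewrite /re Re_subc. Qed.

Lemma imB f g : im (fun x => f x - g x) = fun x => im f x - im g x.
Proof. by apply/funext => x; rewrite /im Im_subc. Qed.

Lemma L2Z c f : L2 f -> L2 (fun x => c * f x).
Proof.
move=> [Hr Hi]; split; rewrite -/(re _) -/(im _).
- by rewrite reZ; apply: Lfun2B; exact: Lfun2Z.
- by rewrite imZ; apply: Lfun2D; exact: Lfun2Z.
Qed.

Lemma L2B f g : L2 f -> L2 g -> L2 (fun x => f x - g x).
Proof.
move=> [Hr Hi] [Gr Gi]; split; rewrite -/(re _) -/(im _).
- by rewrite reB; exact: Lfun2B.
- by rewrite imB; exact: Lfun2B.
Qed.

(** Multiplication by a complex c mixes the two parts, for which [nmC] is not homogeneous in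
    general: hence an inequality and this factor. *)
Lemma nmCZ c f : L2 f -> nmC (fun x => c * f x) <= (`|Re c| + `|Im c|) * nmC f.
Proof.
move=> [Hr Hi]; rewrite /nmC reZ imZ.
have h1 := nm2B (Lfun2Z (Re c) Hr) (Lfun2Z (Im c) Hi).
have h2 := nm2D (Lfun2Z (Re c) Hi) (Lfun2Z (Im c) Hr).
rewrite !nm2Z// in h1 h2; lra.
Qed.

Lemma nmCB f g : L2 f -> L2 g -> nmC (fun x => f x - g x) <= nmC f + nmC g.
Proof.
move=> [Hr Hi] [Gr Gi]; rewrite /nmC reB imB.
have h1 := nm2B Hr Gr; have h2 := nm2B Hi Gi; lra.
Qed.

Lemma nmC_distC f g : nmC (fun x => f x - g x) = nmC (fun x => g x - f x).
Proof.
rewrite /nmC !reB !imB; congr (_ + _); rewrite -nm2N;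
  by congr (nm2 _ _); apply/funext => x; rewrite opprB.
Qed.

Lemma nmC_dist_tri f g h : L2 f -> L2 g -> L2 h ->
  nmC (fun x => f x - h x) <= nmC (fun x => f x - g x) + nmC (fun x => g x - h x).
Proof.
move=> Hf Hg Hh; rewrite (nmC_distC g h).
rewrite (_ : (fun x => f x - h x) = fun x => (f x - g x) - (h x - g x)).
  by apply: nmCB; exact: L2B.
by apply/funext => x; rewrite opprB addrA subrK.
Qed.

Lemma eq_ae_re f g : eq_ae f g -> {ae mu, forall x, re f x = re g x}.
Proof. by apply: filterS => x; rewrite /re => ->. Qed.

Lemma eq_ae_im f g : eq_ae f g -> {ae mu, forall x, im f x = im g x}.
Proof. by apply: filterS => x; rewrite /im => ->. Qed.

Lemma eq_ae_parts f g : {ae mu, forall x, re f x = re g x} ->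
  {ae mu, forall x, im f x = im g x} -> eq_ae f g.
Proof. by move=> /[swap]; apply: filterS2 => x *; exact: complexP. Qed.

Lemma eq_ae_nmC f g : L2 f -> L2 g -> eq_ae f g -> nmC f = nmC g.
Proof.
move=> [Hr Hi] [Gr Gi] fg; congr (_ + _).
- exact: eq_ae_nm2 (eq_ae_re fg).
- exact: eq_ae_nm2 (eq_ae_im fg).
Qed.

Lemma nmC_eq0 f : L2 f -> nmC f = 0 -> eq_ae f (fun=> 0).
Proof.
move=> [Hr Hi] /eqP; rewrite paddr_eq0 ?nm2_ge0// => /andP[/eqP r0 /eqP i0].
by apply: eq_ae_parts; [exact: nm2_eq0 Hr r0|exact: nm2_eq0 Hi i0].
Qed.

(** In each real pairing h stands on the left, so linearity in f becomes linearity of [ip] on the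
    right. *)
Lemma inner_ip f h : L2 f -> L2 h ->
  inner f h = (ip mu (re h) (re f) + ip mu (im h) (im f)) +i*
              (ip mu (re h) (im f) - ip mu (im h) (re f)).
Proof.
move=> [Hr Hi] [Gr Gi]; rewrite /inner /cintegral /ip; congr (_ +i* _).
- rewrite -RintegralD//; try exact: integrable_mul2.
  apply: eq_Rintegral => x _; rewrite Re_mulc /re /im.
  by case: (f x) (h x) => a b [c d] /=; ring.
- rewrite -RintegralB//; try exact: integrable_mul2.
  apply: eq_Rintegral => x _; rewrite Im_mulc /re /im.
  by case: (f x) (h x) => a b [c d] /=; ring.
Qed.

Lemma innerZl c f h : L2 f -> L2 h ->
  inner (fun x => c * f x) h = c * inner f h.
Proof.
move=> Hf Hh; have [Hr Hi] := Hf; have [Gr Gi] := Hh.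
rewrite (inner_ip (L2Z c Hf) Hh) (inner_ip Hf Hh) reZ imZ.
rewrite !ipBr ?ipDr ?ipZr//; try exact: Lfun2Z.
by apply: complexP; rewrite ?Re_mulc ?Im_mulc /=; ring.
Qed.

Lemma innerZr c f h : L2 f -> L2 h ->
  inner f (fun x => c * h x) = conjc c * inner f h.
Proof.
move=> Hf Hh; have [Hr Hi] := Hf; have [Gr Gi] := Hh.
rewrite (inner_ip Hf (L2Z c Hh)) (inner_ip Hf Hh) reZ imZ.
rewrite !ipBl ?ipDl ?ipZl//; try exact: Lfun2Z.
by apply: complexP; rewrite ?Re_mulc ?Im_mulc; case: c => a b /=; ring.
Qed.

Lemma innerBl f g h : L2 f -> L2 g -> L2 h ->
  inner (fun x => f x - g x) h = inner f h - inner g h.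
Proof.
move=> Hf Hg Hh; have [Hr Hi] := Hf; have [Gr Gi] := Hg; have [Ir Ii] := Hh.
rewrite (inner_ip (L2B Hf Hg) Hh) (inner_ip Hf Hh) (inner_ip Hg Hh) reB imB.
rewrite !ipBr//.
by apply: complexP; rewrite ?Re_subc ?Im_subc /=; ring.
Qed.

Lemma eq_ae_innerl f g h : L2 f -> L2 g -> L2 h -> eq_ae f g ->
  inner f h = inner g h.
Proof.
move=> Hf Hg Hh fg; have [Hr Hi] := Hf; have [Gr Gi] := Hg; have [Ir Ii] := Hh.
rewrite (inner_ip Hf Hh) (inner_ip Hg Hh).
by rewrite !(eq_ae_ip _ Hr Gr (eq_ae_re fg))// !(eq_ae_ip _ Hi Gi (eq_ae_im fg)).
Qed.

Lemma eq_ae_innerr f g h : L2 f -> L2 g -> L2 h -> eq_ae g h ->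
  inner f g = inner f h.
Proof.
move=> Hf Hg Hh gh; have [Hr Hi] := Hf; have [Gr Gi] := Hg; have [Ir Ii] := Hh.
rewrite (inner_ip Hf Hg) (inner_ip Hf Hh).
rewrite ![ip mu (re g) _]ipC ![ip mu (im g) _]ipC.
rewrite !(eq_ae_ip _ Gr Ir (eq_ae_re gh))// !(eq_ae_ip _ Gi Ii (eq_ae_im gh))//.
by rewrite ![ip mu _ (re h)]ipC ![ip mu _ (im h)]ipC.
Qed.

(** Cauchy-Schwarz on the four real pairings; each part uses two of the four terms of the product of
    the norms. *)
Lemma inner_le f h : L2 f -> L2 h ->
  `|Re (inner f h)| <= nmC f * nmC h /\ `|Im (inner f h)| <= nmC f * nmC h.
Proof.
move=> Hf Hh; have [Hr Hi] := Hf; have [Gr Gi] := Hh.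
rewrite inner_ip//=.
have h1 := ip_le Gr Hr; have h2 := ip_le Gi Hi.
have h3 := ip_le Gr Hi; have h4 := ip_le Gi Hr.
have := nm2_ge0 mu (re f); have := nm2_ge0 mu (im f).
have := nm2_ge0 mu (re h); have := nm2_ge0 mu (im h).
rewrite /nmC => *; split.
- apply: le_trans (ler_normD _ _) _; nra.
- apply: le_trans (ler_normB _ _) _; nra.
Qed.

Lemma ccvg_inner (f_ : nat -> R -> R[i]) f h : (forall n, L2 (f_ n)) ->
  L2 f -> L2 h -> nmC (fun x => f_ n x - f x) @[n --> \oo] --> (0 : R) ->
  ccvg (fun n => inner (f_ n) h) (inner f h).
Proof.
move=> Hf_ Hf Hh ff.
have bound0 : nmC (fun x => f_ n x - f x) * nmC h @[n --> \oo] --> (0 : R).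
  by rewrite -(mul0r (nmC h)); apply: cvgMl.
have sq (z : R) (z_ : nat -> R) :
    (forall n, `|z_ n - z| <= nmC (fun x => f_ n x - f x) * nmC h) ->
    z_ n @[n --> \oo] --> z.
  move=> Hz; apply/cvgrPdist_lt => e e0.
  have /cvgr0Pnorm_lt/(_ _ e0) := bound0; apply: filterS => n /(le_lt_trans _) lt.
  by rewrite distrC lt// (le_trans (Hz n))// ler_norm.
split; apply: sq => n; rewrite -?Re_subc -?Im_subc -innerBl//.
- exact: (inner_le (L2B (Hf_ n) Hf) Hh).1.
- exact: (inner_le (L2B (Hf_ n) Hf) Hh).2.
Qed.

End L2_complex.

(** * Operators with real kernel on complex L^2 *)

Section complex_integral_operators.
Context (R : realType).
Local Notation mu := (m01 R).
Local Notation L2r := (Lfun mu 2%:E).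
Local Notation L2k := (Lfun (m01x01 R) 2%:E).
Local Notation nmk := (nm2 (m01x01 R)).
Local Notation Re := complex.Re.
Local Notation Im := complex.Im.
Local Notation L := (@integral_operator R).
Implicit Types (f g h : R -> R[i]) (c : R[i]) (k l : R * R -> R).

(** A real kernel acts on the two parts separately, which reduces the complex operator to [iop]. *)
Lemma re_integral_operator k f : re (L k f) = iop mu k (re f).
Proof.
apply/funext => x; apply: eq_Rintegral => y _.
by rewrite Re_mulc /= mul0r subr0.
Qed.

Lemma im_integral_operator k f : im (L k f) = iop mu k (im f).
Proof.
apply/funext => x; apply: eq_Rintegral => y _.
by rewrite Im_mulc /= mul0r addr0.
Qed.

Lemma L2_integral_operator k f : k \in L2k -> L2 f -> L2 (L k f).
Proof.
move=> Hk [Hr Hi]; split; rewrite -/(re _) -/(im _).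
- by rewrite re_integral_operator; exact: iop_L2.
- by rewrite im_integral_operator; exact: iop_L2.
Qed.

Lemma nmC_integral_operator k f : k \in L2k -> L2 f ->
  nmC (L k f) <= nmk k * nmC f.
Proof.
move=> Hk [Hr Hi]; rewrite /nmC re_integral_operator im_integral_operator.
by rewrite mulrDr lerD//; exact: nm2_iop.
Qed.

Lemma integral_operatorBr k f g : k \in L2k -> L2 f -> L2 g ->
  eq_ae (L k (fun y => f y - g y)) (fun x => L k f x - L k g x).
Proof.
move=> Hk [Hr Hi] [Gr Gi]; apply: eq_ae_parts.
- by rewrite reB !re_integral_operator reB; exact: iopBr.
- by rewrite imB !im_integral_operator imB; exact: iopBr.
Qed.

Lemma integral_operatorBl k l f : k \in L2k -> l \in L2k -> L2 f ->
  eq_ae (L (fun z => k z - l z) f) (fun x => L k f x - L l f x).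
Proof.
move=> Hk Hl [Hr Hi]; apply: eq_ae_parts.
- by rewrite reB !re_integral_operator; exact: iopBl.
- by rewrite imB !im_integral_operator; exact: iopBl.
Qed.

Lemma integral_operatorZl (a : R) k f : k \in L2k -> L2 f ->
  eq_ae (L (fun z => a * k z) f) (fun x => a%:C * L k f x).
Proof.
move=> Hk [Hr Hi]; apply: eq_ae_parts.
- rewrite reZ !re_integral_operator.
  by apply: filterS (iopZl a Hk Hr) => x e; rewrite /= mul0r subr0; exact: e.
- rewrite imZ !im_integral_operator.
  by apply: filterS (iopZl a Hk Hi) => x e; rewrite /= mul0r addr0; exact: e.
Qed.

Lemma integral_operatorZr c k f : k \in L2k -> L2 f ->
  eq_ae (L k (fun y => c * f y)) (fun x => c * L k f x).
Proof.
move=> Hk [Hr Hi]; have Z := @Lfun2Z _ _ _ mu; apply: eq_ae_parts.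
- rewrite reZ !re_integral_operator im_integral_operator reZ.
  move: (iopBr Hk (Z (Re c) _ Hr) (Z (Im c) _ Hi)) (iopZr (Re c) Hk Hr)
    (iopZr (Im c) Hk Hi).
  by apply: filterS3 => x e1 e2 e3; rewrite -[in RHS]e2 -[in RHS]e3; exact: e1.
- rewrite imZ !im_integral_operator re_integral_operator imZ.
  move: (iopDr Hk (Z (Re c) _ Hi) (Z (Im c) _ Hr)) (iopZr (Re c) Hk Hi)
    (iopZr (Im c) Hk Hr).
  by apply: filterS3 => x e1 e2 e3; rewrite -[in RHS]e2 -[in RHS]e3; exact: e1.
Qed.

Lemma eq_ae_integral_operator k f g : k \in L2k -> L2 f -> L2 g ->
  eq_ae f g -> eq_ae (L k f) (L k g).
Proof.
move=> Hk [Hr Hi] [Gr Gi] fg; apply: eq_ae_parts.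
- by rewrite !re_integral_operator; exact: eq_ae_iop (eq_ae_re fg).
- by rewrite !im_integral_operator; exact: eq_ae_iop (eq_ae_im fg).
Qed.

Definition cconj f : R -> R[i] := fun x => conjc (f x).

Lemma re_cconj f : re (cconj f) = re f.
Proof. by apply/funext => x; rewrite /re /cconj; case: (f x). Qed.

Lemma im_cconj f : im (cconj f) = fun x => - im f x.
Proof. by apply/funext => x; rewrite /im /cconj; case: (f x). Qed.

Lemma L2_cconj f : L2 f -> L2 (cconj f).
Proof.
move=> [Hr Hi]; split; rewrite -/(re _) -/(im _).
- by rewrite re_cconj.
- by rewrite im_cconj; exact: Lfun2N.
Qed.

Lemma inner_cconj f h : L2 f -> L2 h -> inner (cconj f) (cconj h) = conjc (inner f h).
Proof.
move=> Hf Hh; have [Hr Hi] := Hf; have [Gr Gi] := Hh.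
rewrite (inner_ip (L2_cconj Hf) (L2_cconj Hh)) (inner_ip Hf Hh).
rewrite !re_cconj !im_cconj.
rewrite ipNr ?ipNl//; last exact: Lfun2N.
rewrite ipNr//.
by apply: complexP => /=; rewrite ?opprK// opprB addrC.
Qed.

Lemma cconj_integral_operator k f : k \in L2k -> L2 f ->
  eq_ae (L k (cconj f)) (cconj (L k f)).
Proof.
move=> Hk [Hr Hi]; apply: eq_ae_parts.
- by rewrite re_cconj !re_integral_operator re_cconj; exact: nearW.
- rewrite im_cconj !im_integral_operator im_cconj.
  rewrite (_ : (fun x => - im f x) = fun x => -1 * im f x); last first.
    by apply/funext => x; rewrite mulN1r.
  by apply: filterS (iopZr (-1) Hk Hi) => x; rewrite mulN1r.
Qed.

(** The inner integral splits for almost every x. Replacing it under the outer integral requires its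
    measurability, which Fubini gives for k times a sum of two tensors. *)
Lemma double_integralE k (a b a' b' : R -> R) :
  k \in L2k -> a \in L2r -> b \in L2r -> a' \in L2r -> b' \in L2r ->
  double_integral (fun x y => k (x, y) * (a x * b y + a' x * b' y)) =
  ip mu a (iop mu k b) + ip mu a' (iop mu k b').
Proof.
move=> Hk Ha Hb Ha' Hb'.
have Hkb := iop_L2 Hk Hb; have Hkb' := iop_L2 Hk Hb'.
transitivity (\int[mu]_x (a x * iop mu k b x + a' x * iop mu k b' x)); last first.
  by rewrite RintegralD//; exact: integrable_mul2.
have inner_eq : {ae mu, forall x, \int[mu]_y (k (x, y) * (a x * b y + a' x * b' y))
    = a x * iop mu k b x + a' x * iop mu k b' x}.
  apply: filterS (ae_section Hk) => x Hkx.
  have e1 := ipDr Hkx (Lfun2Z (a x) Hb) (Lfun2Z (a' x) Hb').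
  by rewrite !ipZr in e1.
have Hab := Lfun2D (Lfun2_tensor Ha Hb) (Lfun2_tensor Ha' Hb').
have mint := measurable_fubini_F (integrable_mul2 Hk Hab).
congr fine; apply: ae_eq_integral => //.
- apply/measurable_EFinP.
  exact: (measurableT_comp (fine_measurable measurableT) mint).
- apply/measurable_EFinP.
  exact: measurable_funD
    (measurable_funM (Lfun2_measurable Ha) (Lfun2_measurable Hkb))
    (measurable_funM (Lfun2_measurable Ha') (Lfun2_measurable Hkb')).
- by apply: filterS inner_eq => x e _; congr EFin.
Qed.

Lemma double_integralBE k (a b a' b' : R -> R) :
  k \in L2k -> a \in L2r -> b \in L2r -> a' \in L2r -> b' \in L2r ->
  double_integral (fun x y => k (x, y) * (a x * b y - a' x * b' y)) =
  ip mu a (iop mu k b) - ip mu a' (iop mu k b').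
Proof.
move=> Hk Ha Hb Ha' Hb'.
rewrite -(ipNl (iop_L2 Hk Hb') Ha') -(double_integralE Hk Ha Hb (Lfun2N Ha') Hb').
congr double_integral; apply/funext => x; apply/funext => y.
by rewrite mulNr.
Qed.

End complex_integral_operators.

(** * Limits of eigenvectors and the derivative of the eigenvalue *)

Section perturbation.
Context (R : realType).
Local Notation mu := (m01 R).
Local Notation L2k := (Lfun (m01x01 R) 2%:E).
Local Notation nmk := (nm2 (m01x01 R)).
Local Notation Re := complex.Re.
Local Notation Im := complex.Im.
Local Notation L := (@integral_operator R).
Implicit Types (f g h e : R -> R[i]) (c lam : R[i]) (k l : R * R -> R).

Lemma integral_operator_compact k (f_ : nat -> R -> R[i]) (C : R) :
  k \in L2k -> (forall n, L2 (f_ n)) -> (forall n, nmC (f_ n) <= C) ->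
  exists s : nat -> nat, s n @[n --> \oo] --> \oo /\
    exists2 g, L2 g &
      nmC (fun x => L k (f_ (s n)) x - g x) @[n --> \oo] --> (0 : R).
Proof.
move=> Hk Hf fC; have [A genA setIA] := measurableTypeR_rays R.
have fCr n : nm2 mu (re (f_ n)) <= C.
  by apply: le_trans (fC n); rewrite lerDl nm2_ge0.
have fCi n : nm2 mu (im (f_ n)) <= C.
  by apply: le_trans (fC n); rewrite lerDr nm2_ge0.
have [s1 [s1oo [U HU cU]]] :=
  iop_compact genA setIA Hk (fun n => (Hf n).1) fCr.
(* The imaginary parts are extracted along [s1], so that both parts converge along the composite. *)
have [s2 [s2oo [V HV cV]]] :=
  iop_compact genA setIA Hk (fun n => (Hf (s1 n)).2) (fun n => fCi (s1 n)).
exists (s1 \o s2); split; first exact: cvg_comp s2oo s1oo.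
exists (fun x => U x +i* V x); first by [].
rewrite -[0]addr0; apply: cvgD.
- under eq_fun do rewrite reB re_integral_operator.
  exact: cvg_comp s2oo cU.
- by under eq_fun do rewrite imB im_integral_operator.
Qed.

Lemma normalized_eigenvector k c : k \in L2k -> Defs.eigenvalue (L k) c ->
  exists f, [/\ L2 f, nmC f = 1 & eq_ae (L k f) (fun x => c * f x)].
Proof.
move=> Hk [f [Hf f0 Lf]].
have nf0 : 0 < nmC f.
  rewrite lt_neqAle nmC_ge0 andbT eq_sym; apply/eqP => nf.
  by apply: f0; exact: nmC_eq0.
(* A real scalar: [nmC] is homogeneous for it, so the norm becomes exactly 1. *)
pose a := ((nmC f)^-1)%:C.
exists (fun x => a * f x); split; first exact: L2Z.
- have [Hr Hi] := Hf; rewrite /nmC reZ imZ /=.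
  rewrite (_ : (fun x => _ - _) = fun x => (nmC f)^-1 * re f x); last first.
    by apply/funext => x; rewrite mul0r subr0.
  rewrite (_ : (fun x => _ + _) = fun x => (nmC f)^-1 * im f x); last first.
    by apply/funext => x; rewrite mul0r addr0.
  by rewrite !nm2Z// -mulrDr ger0_norm ?invr_ge0 ?nmC_ge0// mulVf// gt_eqF.
- apply: filterS2 (integral_operatorZr a Hk Hf) Lf => x -> ->.
  by rewrite mulrCA.
Qed.

Lemma nmC_integral_operator_sub k l f : k \in L2k -> l \in L2k -> L2 f ->
  nmC (fun x => L k f x - L l f x) <= nmk (fun z => k z - l z) * nmC f.
Proof.
move=> Hk Hl Hf; have Hkl := Lfun2B Hk Hl.
rewrite -(eq_ae_nmC _ _ (integral_operatorBl Hk Hl Hf)).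
- exact: nmC_integral_operator.
- exact: L2_integral_operator.
- by apply: L2B; exact: L2_integral_operator.
Qed.

Lemma nmC_sub_integral_operator k f g : k \in L2k -> L2 f -> L2 g ->
  nmC (fun x => L k f x - L k g x) <= nmk k * nmC (fun x => f x - g x).
Proof.
move=> Hk Hf Hg; have Hfg := L2B Hf Hg.
rewrite -(eq_ae_nmC _ _ (integral_operatorBr Hk Hf Hg)).
- exact: nmC_integral_operator.
- exact: L2_integral_operator.
- by apply: L2B; exact: L2_integral_operator.
Qed.

Lemma eigenvector_limit (k_ : nat -> R * R -> R) k (f_ : nat -> R -> R[i])
    (z : nat -> R[i]) lam :
  (forall n, k_ n \in L2k) -> k \in L2k ->
  nmk (fun w => k_ n w - k w) @[n --> \oo] --> (0 : R) ->
  (forall n, L2 (f_ n)) -> (forall n, nmC (f_ n) = 1) ->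
  (forall n, eq_ae (L (k_ n) (f_ n)) (fun x => z n * f_ n x)) ->
  ccvg z lam -> lam != 0 ->
  exists s : nat -> nat, s n @[n --> \oo] --> \oo /\
    exists2 f, eigenvector (L k) lam f &
      nmC (fun x => f_ (s n) x - f x) @[n --> \oo] --> (0 : R).
Proof.
move=> Hk_ Hk kk Hf f1 Lf zlam lam0.
have f_le1 n : nmC (f_ n) <= 1 by rewrite f1.
have [s [soo [g Hg cg]]] := integral_operator_compact Hk Hf f_le1.
exists s; split=> //.
pose f x := lam^-1 * g x; have L2f : L2 f by exact: L2Z.
have Lk n : L2 (L k (f_ n)) by exact: L2_integral_operator.
pose K := `|Re lam^-1| + `|Im lam^-1|.
have K0 : 0 <= K by rewrite addr_ge0.
(* With z f = L_(k_n) f, the vector lam f - g is (lam - z) f + (L_(k_n) - L_k) f + (L_k f - g). The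
   three terms are bounded using [nmC] f = 1, and K accounts for the division by lam. *)
pose bd n := K * (`|Re lam - Re (z (s n))| + `|Im lam - Im (z (s n))| +
  (nmk (fun w => k_ (s n) w - k w) + nmC (fun x => L k (f_ (s n)) x - g x))).
have f_le n : nmC (fun x => f_ (s n) x - f x) <= bd n.
  have H1 : L2 (fun x => lam * f_ (s n) x) by exact: L2Z.
  have H2 : L2 (fun x => z (s n) * f_ (s n) x) by exact: L2Z.
  have H3 : L2 (L (k_ (s n)) (f_ (s n))) by exact: L2_integral_operator.
  rewrite (_ : (fun x => f_ (s n) x - f x) =
      fun x => lam^-1 * (lam * f_ (s n) x - g x)); last first.
    by apply/funext => x; rewrite mulrBr mulKf.
  apply: le_trans (nmCZ _ (L2B H1 Hg)) _; apply: ler_wpM2l => //.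
  apply: le_trans (nmC_dist_tri H1 H2 Hg) _; apply: lerD.
    rewrite (_ : (fun x => _ - _) = fun x => (lam - z (s n)) * f_ (s n) x).
      by apply: le_trans (nmCZ _ (Hf _)) _; rewrite f1 mulr1 Re_subc Im_subc.
    by apply/funext => x; rewrite mulrBl.
  rewrite -(@eq_ae_nmC _ (fun x => L (k_ (s n)) (f_ (s n)) x - g x));
    [|exact: L2B|exact: L2B|]; last by apply: filterS (Lf (s n)) => x ->.
  apply: le_trans (nmC_dist_tri H3 (Lk (s n)) Hg) _; rewrite lerD2r.
  by apply: le_trans (nmC_integral_operator_sub _ _ _) _ => //; rewrite f1 mulr1.
have bd0 : bd n @[n --> \oo] --> (0 : R).
  have [zr zi] := ccvg_sub soo zlam.
  have d0 (a : R) (a_ : nat -> R) : a_ n @[n --> \oo] --> a ->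
      `|a - a_ n| @[n --> \oo] --> (0 : R).
    move=> aa; rewrite -(normr0 R) -(subrr a).
    by apply: cvg_norm; apply: cvgB => //; exact: cvg_cst.
  rewrite /bd (_ : 0 = K * (0 + 0 + (0 + 0))); last by rewrite !addr0 mulr0.
  apply: cvgMr; apply: cvgD; first by apply: cvgD; exact: d0.
  by apply: cvgD => //; exact: cvg_comp soo kk.
have ff : nmC (fun x => f_ (s n) x - f x) @[n --> \oo] --> (0 : R).
  apply: (squeeze_cvgr _ (cvg_cst 0) bd0).
  by apply: nearW => n; rewrite nmC_ge0 f_le.
exists f => //; split=> //.
(* The normalisation keeps the limit away from 0: for f = 0 a.e. the distances would all equal 1. *)
- move=> f0.
  have one n : nmC (fun x => f_ (s n) x - f x) = 1.
    rewrite -[RHS](f1 (s n)); apply: eq_ae_nmC => //; first exact: L2B.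
    by apply: filterS f0 => x ->; rewrite subr0.
  have : (1 : R) <= 0.
    by apply: (ler_cvg_to (cvg_cst _) ff); apply: nearW => n; rewrite one.
  by rewrite ler10.
- have Lkf : L2 (L k f) by exact: L2_integral_operator.
  (* Along s, L_k f_n tends to g and, by continuity, to L_k f; hence L_k f = g = lam f. *)
  have : nmC (fun x => L k f x - g x) = 0.
    apply/le_anti; rewrite nmC_ge0 andbT.
    have lim0 : nmk k * nmC (fun x => f_ (s n) x - f x) +
        nmC (fun x => L k (f_ (s n)) x - g x) @[n --> \oo] --> (0 : R).
      rewrite -[0]addr0; apply: cvgD => //.
      by rewrite -(mulr0 (nmk k)); exact: cvgMr.
    apply: (ler_cvg_to (cvg_cst _) lim0); apply: nearW => n.
    apply: le_trans (nmC_dist_tri Lkf (Lk (s n)) Hg) _; rewrite lerD2r nmC_distC.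
    exact: nmC_sub_integral_operator.
  move/(nmC_eq0 (L2B Lkf Hg)); apply: filterS => x /subr0_eq ->.
  by rewrite /f mulVKf.
Qed.

(** The adjoint equation enters as an identity tested on L^2, a form that holds for ehat and, when
    lam0 is real, for its conjugate as well. *)
Lemma eigenvalue_derivative (k_ : nat -> R * R -> R) k kdot (t : nat -> R)
    (z : nat -> R[i]) lam lamdot e h :
  (forall n, k_ n \in L2k) -> k \in L2k -> kdot \in L2k ->
  (forall n, t n != 0) -> t n @[n --> \oo] --> (0 : R) ->
  nmk (fun w => (t n)^-1 * (k_ n w - k w) - kdot w) @[n --> \oo] --> (0 : R) ->
  ccvg (fun n => (z n - lam) / (t n)%:C) lamdot ->
  (forall n, Defs.eigenvalue (L (k_ n)) (z n)) ->
  lam != 0 -> geometrically_simple (L k) lam -> eigenvector (L k) lam e ->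
  L2 h -> (forall f, L2 f -> inner (L k f) h = lam * inner f h) ->
  inner (L kdot e) h = lamdot * inner e h.
Proof.
move=> Hk_ Hk Hkd t0 tcv kcv zcv ev lam0 [e0 [_ simple]] eige Hh weak.
have [f_ Hf_] := choice (fun n => normalized_eigenvector (Hk_ n) (ev n)).
have Hf n : L2 (f_ n) by have [] := Hf_ n.
have f1 n : nmC (f_ n) = 1 by have [] := Hf_ n.
have Lf n : eq_ae (L (k_ n) (f_ n)) (fun x => z n * f_ n x) by have [] := Hf_ n.
pose dk n w := k_ n w - k w; pose q n w := (t n)^-1 * dk n w.
have Hdk n : dk n \in L2k by exact: Lfun2B.
have Hq n : q n \in L2k by exact: Lfun2Z.
have Hqd n : (fun w => q n w - kdot w) \in L2k by exact: Lfun2B.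
have tz : ccvg (fun n => (t n)%:C) 0 by split=> //; exact: cvg_cst.
(* z_n - lam is a convergent quotient times t_n -> 0. *)
have zlam : ccvg z lam.
  have [] := ccvgM zcv tz; rewrite mulr0 => zr zi.
  have zE n : (z n - lam) / (t n)%:C * (t n)%:C = z n - lam.
    by rewrite divfK// eq_complex/= (negbTE (t0 n)).
  split.
  - rewrite (_ : (fun n => _) = fun n => Re (z n - lam) + Re lam); last first.
      by apply/funext => n; rewrite Re_subc subrK.
    rewrite -[X in _ --> X]add0r; apply: cvgD; last exact: cvg_cst.
    by move: zr; under eq_fun do rewrite zE.
  - rewrite (_ : (fun n => _) = fun n => Im (z n - lam) + Im lam); last first.
      by apply/funext => n; rewrite Im_subc subrK.
    rewrite -[X in _ --> X]add0r; apply: cvgD; last exact: cvg_cst.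
    by move: zi; under eq_fun do rewrite zE.
have kk : nmk (fun w => k_ n w - k w) @[n --> \oo] --> (0 : R).
  have bd0 : `|t n| * (nmk (fun w => q n w - kdot w) + nmk kdot) @[n --> \oo]
      --> (0 : R).
    rewrite -(mul0r (0 + nmk kdot)); apply: cvgM.
      by rewrite -(normr0 R); exact: cvg_norm.
    by apply: cvgD => //; exact: cvg_cst.
  apply: (squeeze_cvgr _ (cvg_cst 0) bd0); apply: nearW => n.
  rewrite nm2_ge0/= (_ : (fun w => _) = fun w => t n * q n w); last first.
    by apply/funext => w; rewrite /q mulVKf.
  rewrite nm2Z// ler_wpM2l//.
  apply: le_trans (nm2D (Hqd n) Hkd).
  rewrite (_ : (fun w => q n w - kdot w + kdot w) = q n)//.
  by apply/funext => w; rewrite subrK.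
have [s [soo [f eigf fcv]]] := eigenvector_limit Hk_ Hk kk Hf f1 Lf zlam lam0.
have [Lf2 f0 Lkf] := eigf; have [Le2 _ _] := eige.
have Lop k' g : k' \in L2k -> L2 g -> L2 (L k' g) by exact: L2_integral_operator.
have Lq n : L2 (L (q n) (f_ n)) := Lop _ _ (Hq n) (Hf n).
have Ldk n : L2 (L (dk n) (f_ n)) := Lop _ _ (Hdk n) (Hf n).
have Lk_ n : L2 (L (k_ n) (f_ n)) := Lop _ _ (Hk_ n) (Hf n).
have Lk n : L2 (L k (f_ n)) := Lop _ _ Hk (Hf n).
have Lkdf : L2 (L kdot f) := Lop _ _ Hkd Lf2.
have key n : inner (L (q n) (f_ n)) h =
    (z n - lam) / (t n)%:C * inner (f_ n) h.
  have H1 := integral_operatorZl (t n)^-1 (Hdk n) (Hf n).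
  rewrite (eq_ae_innerl (Lq n) (L2Z _ (Ldk n)) Hh H1) (innerZl _ (Ldk n) Hh).
  have H2 := integral_operatorBl (Hk_ n) Hk (Hf n).
  rewrite (eq_ae_innerl (Ldk n) (L2B (Lk_ n) (Lk n)) Hh H2).
  rewrite (innerBl (Lk_ n) (Lk n) Hh) weak//.
  rewrite (eq_ae_innerl (Lk_ n) (L2Z _ (Hf n)) Hh (Lf n)).
  by rewrite innerZl// -mulrBl fmorphV mulrCA mulrA.
(* L_q f_n - L_kdot f = (L_q - L_kdot) f_n + L_kdot (f_n - f), with f_n of norm 1. *)
have lhs : ccvg (fun n => inner (L (q (s n)) (f_ (s n))) h) (inner (L kdot f) h).
  apply: (ccvg_inner (fun n => Lq (s n)) Lkdf Hh).
  have bd0 : nmk (fun w => q (s n) w - kdot w) +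
      nmk kdot * nmC (fun x => f_ (s n) x - f x) @[n --> \oo] --> (0 : R).
    rewrite -[0]addr0; apply: cvgD; first exact: cvg_comp soo kcv.
    by rewrite -(mulr0 (nmk kdot)); exact: cvgMr.
  apply: (squeeze_cvgr _ (cvg_cst 0) bd0); apply: nearW => n; rewrite nmC_ge0/=.
  have H1 := nmC_dist_tri (Lop _ _ (Hq (s n)) (Hf (s n)))
    (Lop _ _ Hkd (Hf (s n))) (Lop _ _ Hkd Lf2).
  apply: le_trans H1 _; apply: lerD.
    by apply: le_trans (nmC_integral_operator_sub _ _ _) _ => //; rewrite f1 mulr1.
  exact: nmC_sub_integral_operator.
have rhs := ccvgM (ccvg_sub soo zcv)
  (ccvg_inner (fun n => Hf (s n)) Lf2 Hh fcv).
have fE : inner (L kdot f) h = lamdot * inner f h.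
  apply: (ccvg_unique lhs); move: rhs; congr (ccvg _ _).
  by apply/funext => n /=; rewrite key.
(* The limit f need not be e: both are multiples of [e0], and f is nonzero, so e is a multiple of f
   and the identity is linear in that multiple. *)
have [c1 f_e0] := simple _ eigf; have [c2 e_e0] := simple _ eige.
have c10 : c1 != 0.
  apply/eqP => c10; apply: f0; apply: filterS f_e0 => x ->.
  by rewrite c10 mul0r.
have e_f : eq_ae e (fun x => c2 / c1 * f x).
  by apply: filterS2 f_e0 e_e0 => x -> ->; rewrite mulrA divfK.
have Lc := L2Z (c2 / c1) Lf2.
rewrite (eq_ae_innerl Le2 Lc Hh e_f) (innerZl _ Lf2 Hh).
rewrite (eq_ae_innerl (Lop _ _ Hkd Le2) (Lop _ _ Hkd Lc) Hh
  (eq_ae_integral_operator Hkd Le2 Lc e_f)).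
rewrite (eq_ae_innerl (Lop _ _ Hkd Lc) (L2Z _ Lkdf) Hh
  (integral_operatorZr _ Hkd Lf2)).
by rewrite (innerZl _ Lkdf Hh) fE mulrCA.
Qed.

End perturbation.

(** * One-sided limits at 0 and the conclusion *)

Lemma C1_complex_cvg0 (R : realType) (b : R) (lam : R -> R[i]) : 0 < b ->
  C1_complex b lam -> exists lamdot : R[i],
    Normc.normc ((lam d - lam 0) / d%:C - lamdot) @[d --> 0^'+] --> (0 : R).
Proof.
move=> b0 [lam' [_ + _]]; move=> /(_ 0); rewrite lexx b0 => /(_ isT) Hlam.
exists (lam' 0) => V nV.
(* At s = 0 the punctured filter within [0, b) is the right-hand filter, since t < b near 0. *)
have HV : nbhs (0 : R) (fun t => t != 0 -> 0 <= t < b ->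
    V (Normc.normc ((t - 0)^-1 *: (lam t - lam 0 : Rcomplex R) - lam' 0))).
  exact: (Hlam V nV).
have Hb : \forall t \near nbhs (0 : R), t < b.
  exact: lt_nbhsl.
apply: filterS2 HV Hb => t Ht tb t0.
have := Ht (lt0r_neq0 t0); rewrite tb ltW// => /(_ isT).
(* In [Rcomplex R] a real scalar acts on both parts, that is, by multiplication with its image in
   R[i]. *)
congr (V (Normc.normc (_ - _))); rewrite subr0 -fmorphV mulrC.
by case: (lam t - lam 0) => x y; apply: complexP => /=; ring.
Qed.

(** The offset 2 keeps every term below b, already at n = 0, so that the branch is defined along the
    whole sequence. *)
Lemma cvg_harmonic_at_right (R : realType) (b : R) : 0 < b ->
  b / n.+2%:R @[n --> \oo] --> (0 : R)^'+.
Proof.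
move=> b0.
have h0 : b / n.+2%:R @[n --> \oo] --> (0 : R).
  rewrite -(mulr0 b); apply: cvgMr.
  by have := @cvg_harmonic R; rewrite -cvg_shiftS.
move=> V HV.
have HV' : \forall n \near \oo, 0 < b / n.+2%:R -> V (b / n.+2%:R) := h0 _ HV.
by apply: filterS HV' => n; apply; exact: divr_gt0.
Qed.

Theorem corollary3p6 (R : realType)
    (dbar : R) (hdbar : 0 < dbar)
    (k : R -> R * R -> R) (hk : C1_kernel dbar k)
    (hint : forall d, 0 <= d < dbar ->
       integral_preserving (integral_operator (k d)))
    (hA1 : mixing (integral_operator (k 0)))
    (kdot : R * R -> R) (hkdot : kernel_derivative0 k kdot)
    (L0adj : (R -> R[i]) -> R -> R[i])
    (hadj : is_adjoint (integral_operator (k 0)) L0adj)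
    (lam0 : R[i])
    (hlam0 : largest_in_open_disk (integral_operator (k 0)) lam0)
    (hsimple : geometrically_simple (integral_operator (k 0)) lam0)
    (d1 : R) (hd1 : 0 < d1 <= dbar)
    (lam : R -> R[i]) (hlam : eigenvalue_branch k lam0 d1 lam) :
  exists lamdot : R[i],
    (Normc.normc ((lam d - lam0) / d%:C - lamdot) @[d --> 0^'+] --> (0 : R)) /\
    (lam0 != 0 ->
     forall e ehat : R -> R[i],
       eigenvector (integral_operator (k 0)) lam0 e ->
       inner e ehat = 1 ->
       (eigenvector L0adj lam0 ehat ->
        lamdot =
          (double_integral (fun x y => kdot (x, y) *
             (complex.Re (ehat x) * complex.Re (e y) +
              complex.Im (ehat x) * complex.Im (e y)))) +i*
          (double_integral (fun x y => kdot (x, y) *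
             (complex.Im (ehat x) * complex.Re (e y) -
              complex.Re (ehat x) * complex.Im (e y))))) /\
       (eigenvector L0adj lam0^* ehat ->
        lamdot =
          (double_integral (fun x y => kdot (x, y) *
             (complex.Re (ehat x) * complex.Re (e y) +
              complex.Im (ehat x) * complex.Im (e y)))) +i*
          (double_integral (fun x y => kdot (x, y) *
             (complex.Re (ehat x) * complex.Im (e y) -
              complex.Im (ehat x) * complex.Re (e y)))))).
Proof.
have conjK (c : R[i]) : conjc (conjc c) = c by case: c => a b /=; rewrite opprK.
have [d1_gt0 d1_le] := andP hd1; have [C1lam lam00 ev] := hlam.
have [lamdot Hlamdot] := C1_complex_cvg0 d1_gt0 C1lam.
rewrite lam00 in Hlamdot; exists lamdot; split=> // lam0_neq0 e ehat eige e1.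
have [k' [Hk' _ _]] := hk; have [Hkd kd0] := hkdot.
have Hk d : 0 <= d < d1 -> k d \in Lfun (m01x01 R) 2%:E.
  move=> /andP[d0 dd1]; apply: (Hk' d _).1.
  by rewrite d0 (lt_le_trans dd1).
have Hk0 : k 0 \in Lfun (m01x01 R) 2%:E by apply: Hk; rewrite lexx.
pose t n := d1 / n.+2%:R.
have t_gt0 n : 0 < t n by rewrite divr_gt0.
have t_lt n : 0 <= t n < d1.
  by rewrite ltW//= ltr_pdivrMr// ltr_pMr// ltr1n.
have t_right : t n @[n --> \oo] --> (0 : R)^'+ := cvg_harmonic_at_right d1_gt0.
have t_cvg0 : t n @[n --> \oo] --> (0 : R).
  by apply: cvg_trans t_right _; exact: cvg_within.
have Hkt n : k (t n) \in Lfun (m01x01 R) 2%:E by exact: Hk.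
have kcv : nm2 (m01x01 R) (fun w => (t n)^-1 * (k (t n) w - k 0 w) - kdot w)
    @[n --> \oo] --> (0 : R).
  (* The positive factor 1/t goes inside the norm and turns the o(t) remainder into difference
     quotient minus kdot. *)
  have := cvg_comp _ _ t_right kd0; apply: cvg_trans; apply: near_eq_cvg.
  apply: nearW => n /=; rewrite -[LHS]/(nm2 _ _ / _).
  rewrite mulrC -[X in X * _]gtr0_norm ?invr_gt0// -nm2Z; last first.
    by apply: Lfun2B; [exact: Lfun2B|exact: Lfun2Z].
  congr (nm2 _ _); apply/funext => w.
  by rewrite mulrBr mulKf// gt_eqF.
have zcv : ccvg (fun n => (lam (t n) - lam0) / (t n)%:C) lamdot.
  have N0 := cvg_comp _ _ t_right Hlamdot.
  split; apply/cvgrPdist_lt => eps eps0;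
    have /cvgr0Pnorm_lt/(_ _ eps0) := N0; apply: filterS => n /=;
    apply: le_lt_trans; rewrite distrC (le_trans _ (ler_norm _))//.
  - by rewrite -Re_subc Re_le_normc.
  - by rewrite -Im_subc Im_le_normc.
have derivE g h : eigenvector (integral_operator (k 0)) lam0 g -> L2 h ->
    (forall f, L2 f -> inner (integral_operator (k 0) f) h = lam0 * inner f h) ->
    inner (integral_operator kdot g) h = lamdot * inner g h.
  move=> eigg Hh weak; apply: (eigenvalue_derivative (k_ := k \o t)
    Hkt Hk0 Hkd _ t_cvg0 kcv zcv _ lam0_neq0 hsimple eigg Hh weak).
  - by move=> n; rewrite gt_eqF.
  - by move=> n; apply: ev; exact: t_lt.
have [L2adj adjE] := hadj; have [L2e e_neq0 Le] := eige.
have L2L f : L2 f -> L2 (integral_operator (k 0) f).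
  exact: L2_integral_operator.
(* [inner] is conjugate linear on the right: mu = conj(lam0) gives the identity with lam0 that
   [derivE] asks for. *)
have weak_adj mu f : eigenvector L0adj mu ehat -> L2 f ->
    inner (integral_operator (k 0) f) ehat = conjc mu * inner f ehat.
  move=> [L2h _ Lh] L2f; rewrite adjE//.
  by rewrite (eq_ae_innerr L2f (L2adj _ L2h) (L2Z _ L2h) Lh) innerZr.
have case2 : eigenvector L0adj lam0^* ehat ->
    lamdot = inner (integral_operator kdot e) ehat.
  move=> eigh; have [L2h _ _] := eigh.
  rewrite (derivE _ _ eige L2h) ?e1 ?mulr1// => f L2f.
  by rewrite (weak_adj _ _ eigh L2f) conjK.
have formula : L2 ehat -> inner (integral_operator kdot e) ehat =
    (double_integral (fun x y => kdot (x, y) *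
       (complex.Re (ehat x) * complex.Re (e y) +
        complex.Im (ehat x) * complex.Im (e y)))) +i*
    (double_integral (fun x y => kdot (x, y) *
       (complex.Re (ehat x) * complex.Im (e y) -
        complex.Im (ehat x) * complex.Re (e y)))).
  move=> L2h; have [hr hi] := L2h; have [er ei] := L2e.
  rewrite (inner_ip (L2_integral_operator Hkd L2e) L2h).
  rewrite re_integral_operator im_integral_operator.
  congr (_ +i* _); first by rewrite double_integralE.
  by rewrite double_integralBE.
split=> [eigh|eigh]; last by have [L2h _ _] := eigh; rewrite (case2 eigh) formula.
have [L2h h_neq0 Lh] := eigh.
(* <L_0 e, ehat> equals lam0 by the equation for e and conj(lam0) by the one for ehat. *)
have lam0_real : conjc lam0 = lam0.
  have := weak_adj _ _ eigh L2e.
  by rewrite (eq_ae_innerl (L2L _ L2e) (L2Z _ L2e) L2h Le) innerZl// e1 !mulr1.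
have eigh' : eigenvector L0adj lam0^* ehat by rewrite lam0_real.
have lamdotE := case2 eigh'.
have L2ce := L2_cconj L2e; have L2ch := L2_cconj L2h.
have eigce : eigenvector (integral_operator (k 0)) lam0 (cconj e).
  split=> //.
  - by move=> ce0; apply: e_neq0; apply: filterS ce0 => x /(congr1 conjc);
      rewrite /cconj conjK => ->; rewrite conjc0.
  - apply: filterS2 (cconj_integral_operator Hk0 L2e) Le => x ->.
    by rewrite /cconj => ->; rewrite rmorphM/= lam0_real.
have weakc f : L2 f -> inner (integral_operator (k 0) f) (cconj ehat) =
    lam0 * inner f (cconj ehat).
  move=> L2f; have L2cf := L2_cconj L2f.
  have fE : f = cconj (cconj f) by apply/funext => x; rewrite /cconj conjK.
  rewrite [in RHS]fE (inner_cconj L2cf L2h).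
  rewrite -lam0_real -rmorphM/= -[in RHS]lam0_real -(weak_adj _ _ eigh L2cf).
  rewrite -(inner_cconj (L2L _ L2cf) L2h).
  have := cconj_integral_operator Hk0 L2cf; rewrite -fE => cE.
  by rewrite (eq_ae_innerl (L2L _ L2f) (L2_cconj (L2L _ L2cf)) L2ch cE).
(* <Ldot conj(e), conj(ehat)> is lamdot by [derivE], and the conjugate of <Ldot e, ehat> = lamdot
   because kdot is real. *)
have lamdot_real : conjc lamdot = lamdot.
  have := derivE _ _ eigce L2ch weakc.
  rewrite (inner_cconj L2e L2h) e1 conjc1 mulr1 => lamdotE'.
  rewrite -[RHS]lamdotE'.
  rewrite (eq_ae_innerl (L2_integral_operator Hkd L2ce)
    (L2_cconj (L2_integral_operator Hkd L2e)) L2ch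
    (cconj_integral_operator Hkd L2e)).
  by rewrite (inner_cconj (L2_integral_operator Hkd L2e) L2h) -lamdotE.
have [hr hi] := L2h; have [er ei] := L2e.
(* The claimed expression is the conjugate of [formula]: the sign of its imaginary part is
   reversed. *)
rewrite -[LHS]lamdot_real lamdotE formula//=; congr (_ +i* _).
by rewrite !double_integralBE// opprB.
Qed.
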